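(* Let $\mathbb H$ be the graded affine Hecke algebra with equal parameters $k_\alpha=1$. Let $\nu\in V^\vee_{\mathbb C}$ be dominant, meaning that $(\alpha,\operatorname{Re}\nu)\ge0$ for all $\alpha\in\Pi$, and let $\overline X(\nu)$ be the unique spherical subquotient of $X(\nu)=\mathbb H\otimes_{S(V_{\mathbb C})}\mathbb C_\nu$. Let $\mathcal C_\infty=\{\lambda\in V^\vee:(\alpha,\lambda)>1\text{ for all }\alpha\in\Pi\}$ and let $\overline{\mathcal C}_\infty$ be its closure. \begin{enumerate} \item If $\operatorname{Im}\nu=0$, then $\overline X(\nu)$ is $\bullet$-unitary if and only if $\nu\in\overline{\mathcal C}_\infty$. \item If $\operatorname{Im}\nu\ne0$, then $\overline X(\nu)$ is not $\bullet$-unitary. \end{enumerate}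
   Context: Root system: $V,V^\vee$ are finite-dimensional real vector spaces with a perfect pairing $(\ ,\ )$; $R\subset V\setminus\{0\}$, $R^\vee\subset V^\vee\setminus\{0\}$ are finite sets in bijection $\alpha\leftrightarrow\alpha^\vee$ with $(\alpha,\alpha^\vee)=2$, stable under the reflections $s_\alpha(v)=v-(v,\alpha^\vee)\alpha$ and $s_\alpha(v')=v'-(\alpha,v')\alpha^\vee$; reduced. $W$ is the group generated by the $s_\alpha$, $\Pi$ the simple roots. $V_{\mathbb C},V_{\mathbb C}^\vee$ are complexifications with complex conjugation $\overline{\phantom{x}}$; for $\nu\in V^\vee_{\mathbb C}$ write $\nu=\operatorname{Re}\nu+\sqrt{-1}\operatorname{Im}\nu$ with $\operatorname{Re}\nu,\operatorname{Im}\nu\in V^\vee$. $\mathbb H\cong\mathbb C[W]\otimes S(V_{\mathbb C})$ (as bimodule via $t_wa\mapsto w\otimes a$) is the unital associative algebra generated by $t_w$ ($w\in W$) and $S(V_{\mathbb C})$ with $a\,t_{s_\alpha}=t_{s_\alpha}s_\alpha(a)+\frac{a-s_\alpha(a)}{\alpha}$ for $\alpha\in\Pi$, $a\in S(V_{\mathbb C})$. The conjugate-linear anti-involution $\bullet$ is given by $t_w^\bullet=t_{w^{-1}}$, $\omega^\bullet=\overline\omega$ for $\omega\in V_{\mathbb C}$. An $\mathbb H$-module $(\pi,X)$ is $\bullet$-unitary if it has a positive definite hermitian form with $(\pi(h)x,y)=(x,\pi(h^\bullet)y)$ for all $h\in\mathbb H$, $x,y\in X$. $\mathbb C_\nu$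 is the character of $S(V_{\mathbb C})$ given by evaluation at $\nu$. $\overline X(\nu)$ is the unique irreducible subquotient of $X(\nu)$ with $\operatorname{Hom}_W[\mathsf{triv},\overline X(\nu)]\ne0$. *)

(* Defs.v *)
From HB Require Import structures.
From mathcomp Require Import all_boot all_order all_algebra.
From mathcomp Require Import generic_quotient ring_quotient.
From mathcomp Require Import complex.
From mathcomp Require Import boolp classical_sets reals topology.
From mathcomp Require Import mpoly.

Set Implicit Arguments.
Unset Strict Implicit.
Unset Printing Implicit Defensive.

Import Order.TTheory GRing.Theory Num.Theory.
Import numFieldTopology.Exports.

Local Open Scope ring_scope.
Local Open Scope complex_scope.

(* No integrality of the numbers (alpha, beta^vee) is assumed, and the roots  *)
(* need not span V.  For finite-dimensional V, V', non-degeneracy on both     *)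
(* sides is perfectness of the pairing.                                       *)
Record root_system (R : realType) (V V' : vectType R) := RootSystem {
  pairing : V -> V' -> R;
  pairing_linl : forall v' : V', scalar (fun v : V => pairing v v');
  pairing_linr : forall v : V, scalar (fun v' : V' => pairing v v');
  pairing_nondegl : forall v : V, (forall v' : V', pairing v v' = 0) -> v = 0;
  pairing_nondegr : forall v' : V', (forall v : V, pairing v v' = 0) -> v' = 0;
  roots : seq V;
  coroot : V -> V';
  coroot_inj : {in roots &, injective coroot};
  pairing_coroot : {in roots, forall a, pairing a (coroot a) = 2};
  roots_refl : {in roots &, forall a b,
    b - pairing b (coroot a) *: a \in roots};
  coroots_refl : {in roots &, forall a b,
    coroot b - pairing a (coroot b) *: coroot a \in map coroot roots};
  roots_reduced : {in roots, forall a (c : R),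
    c *: a \in roots -> c = 1 \/ c = -1}
}.

Section RootSystem.
Context (R : realType) (V V' : vectType R) (rs : root_system V V').

Definition reflection_fun (a v : V) : V := v - pairing rs v (coroot rs a) *: a.

Lemma reflection_fun_linear a : linear (reflection_fun a).
Proof.
move=> c u v; rewrite /reflection_fun pairing_linl scalerDl scalerBr scalerA.
by rewrite opprD addrACA.
Qed.

HB.instance Definition _ a :=
  GRing.isLinear.Build R V V *:%R (reflection_fun a) (reflection_fun_linear a).

Definition reflection (a : V) : 'End(V) := linfun (reflection_fun a).

Lemma reflectionE a v : reflection a v = v - pairing rs v (coroot rs a) *: a.
Proof. by rewrite lfunE. Qed.

(* The s_alpha are involutions, so the monoid they generate is a group. *)
Inductive weyl_group : 'End(V) -> Prop :=
| weyl_group1 : weyl_group \1%VF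
| weyl_groupM a w : a \in roots rs -> weyl_group w ->
    weyl_group (reflection a \o w)%VF.

Definition simple_roots (Pi : seq V) : Prop :=
  [/\ {subset Pi <= roots rs}, free Pi &
      forall b, b \in roots rs -> exists c : V -> R,
        (forall a, a \in Pi -> 0 <= c a) /\
        (b = \sum_(a <- Pi) c a *: a \/ b = - \sum_(a <- Pi) c a *: a)].

End RootSystem.

Record complexified (R : realType) (U : vectType R) :=
  Complexified { re_part : U; im_part : U }.

Definition cconj (R : realType) (U : vectType R) (u : complexified U) :=
  Complexified (re_part u) (- im_part u).

(* S(V_C) is realized as the polynomial ring on the basis vbasis {: V} of V. *)
Definition symalg (R : realType) (V : vectType R) := {mpoly R[i][\dim {: V}]}.

Section SymmetricAlgebra.
Context (R : realType) (V V' : vectType R) (rs : root_system V V').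

Definition sym_of (v : V) : symalg V :=
  \sum_i (coord (vbasis {: V}) i v)%:C *: 'X_i.

Definition sym_ofC (v : complexified V) : symalg V :=
  sym_of (re_part v) + 'i *: sym_of (im_part v).

Definition sym_act (w : 'End(V)) (p : symalg V) :=
  p \mPo [tuple sym_of (w (vbasis {: V})`_i) | i < \dim {: V}].

Lemma sym_of_linear c u v : sym_of (c *: u + v) = c%:C *: sym_of u + sym_of v.
Proof.
rewrite /sym_of scaler_sumr -big_split /=; apply: eq_bigr => i _.
by rewrite linearP /= rmorphD rmorphM scalerDl scalerA.
Qed.

Lemma sym_of_basis (i : 'I_(\dim {: V})) : sym_of (vbasis {: V})`_i = 'X_i.
Proof.
rewrite /sym_of (bigD1 i) //= big1 ?addr0 => [|j ji].
  by rewrite coord_free ?eqxx ?scale1r // (basis_free (vbasisP _)).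
rewrite coord_free ?(basis_free (vbasisP _)) //.
by rewrite eq_sym (negbTE ji) scale0r.
Qed.

Lemma sym_actX w (i : 'I_(\dim {: V})) :
  sym_act w 'X_i = sym_of (w (vbasis {: V})`_i).
Proof. by rewrite /sym_act comp_mpolyXU -tnth_nth tnth_mktuple. Qed.

Lemma sym_act_divides (a : V) p :
  exists q, sym_of a * q == p - sym_act (reflection rs a) p.
Proof.
pose s := sym_act (reflection rs a).
have sD : {morph s : x y / x + y}.
  by move=> x y; rewrite /s /sym_act comp_mpolyD.
elim/mpolyind: p => [|c m p _ _ [q qP]].
  by exists 0; rewrite mulr0 /sym_act comp_mpoly0 subrr.
suff [r rP] : exists r, sym_of a * r = 'X_[m] - s 'X_[m].
  exists (c *: r + q); rewrite mulrDr (eqP qP) -scalerAr rP.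
  by rewrite -/s sD /s /sym_act comp_mpolyZ scalerBr opprD addrACA.
rewrite mpolyXE_id; elim/big_ind: _ => [|x y [q1 e1] [q2 e2]|i _].
- by exists 0; rewrite mulr0 /s /sym_act comp_mpoly1 subrr.
- exists (q1 * y + s x * q2).
  rewrite mulrDr mulrA e1 mulrCA e2 /s /sym_act rmorphM /=.
  by rewrite mulrBl mulrBr addrA subrK.
elim: (m i) => [|k [t e]].
  by exists 0; rewrite mulr0 expr0 /s /sym_act comp_mpoly1 subrr.
have [r rP] : exists r, sym_of a * r = 'X_i - s 'X_i.
  exists (pairing rs (vbasis {: V})`_i (coroot rs a))%:C%:MP.
  rewrite /s sym_actX reflectionE -sym_of_basis.
  rewrite (addrC (vbasis _)`_i) -scaleNr sym_of_linear rmorphN scaleNr.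
  by rewrite opprD opprK addrCA subrr addr0 mulrC mul_mpolyC.
exists (r * 'X_i ^+ k + s 'X_i * t).
rewrite exprS mulrDr mulrA rP mulrCA e /s /sym_act rmorphM /=.
by rewrite mulrBl mulrBr addrA subrK.
Qed.

(* (p - s_alpha(p)) / alpha *)
Definition divdiff (a : V) p := xchoose (sym_act_divides a p).

Lemma divdiffP a p :
  sym_of a * divdiff a p = p - sym_act (reflection rs a) p.
Proof. exact/eqP/(xchooseP (sym_act_divides a p)). Qed.

Definition sym_eval (nu : complexified V') (p : symalg V) : R[i] :=
  p.@[fun i => let b := (vbasis {: V})`_i in
     pairing rs b (re_part nu) +i* pairing rs b (im_part nu)].

End SymmetricAlgebra.

(* theta is the inclusion of S(V_C).  Only the values of t on the Weyl group  *)
(* are meaningful.  The last two fields state that the map                    *)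
(* C[W] (x) S(V_C) -> H, w (x) a |-> t_w a, is onto, resp. one-to-one; they   *)
(* are phrased with finite families of elements of W.                         *)
Record graded_hecke (R : realType) (V V' : vectType R)
    (rs : root_system V V') (Pi : seq V) := GradedHecke {
  hecke_alg :> algType R[i];
  hecke_t : 'End(V) -> hecke_alg;
  hecke_theta : {lrmorphism symalg V -> hecke_alg};
  hecke_t1 : hecke_t \1%VF = 1;
  hecke_tM : forall u w, weyl_group rs u -> weyl_group rs w ->
    hecke_t (u \o w)%VF = hecke_t u * hecke_t w;
  hecke_cross : {in Pi, forall (a : V) (p : symalg V),
    hecke_theta p * hecke_t (reflection rs a) =
    hecke_t (reflection rs a) * hecke_theta (sym_act (reflection rs a) p)
    + hecke_theta (divdiff rs a p)};
  hecke_span : forall h : hecke_alg,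
    exists (ws : seq 'End(V)) (p : 'End(V) -> symalg V),
      (forall w, w \in ws -> weyl_group rs w) /\
      h = \sum_(w <- ws) hecke_t w * hecke_theta (p w);
  hecke_free : forall (ws : seq 'End(V)) (p : 'End(V) -> symalg V),
    uniq ws -> (forall w, w \in ws -> weyl_group rs w) ->
    \sum_(w <- ws) hecke_t w * hecke_theta (p w) = 0 ->
    forall w, w \in ws -> p w = 0
}.

Section Hecke.
Context (R : realType) (V V' : vectType R) (rs : root_system V V').
Context (Pi : seq V) (HH : graded_hecke rs Pi).

Local Notation t := (hecke_t HH).
Local Notation theta := (hecke_theta HH).

Record is_bullet (b : HH -> HH) : Prop := IsBullet {
  bullet_conj_linear : forall (c : R[i]) (h k : HH),
    b (c *: h + k) = Num.conj c *: b h + b k;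
  bullet_antimul : forall h k : HH, b (h * k) = b k * b h;
  bullet_invol : involutive b;
  bullet_t : forall w, weyl_group rs w -> b (t w) = t (w^-1)%VF;
  bullet_theta : forall v : complexified V,
    b (theta (sym_ofC v)) = theta (sym_ofC (cconj v))
}.

(* An H-module is a complex vector space through the scalars c%:A of H. *)
Definition unitary (b : HH -> HH) (X : lmodType HH) : Prop :=
  exists form : X -> X -> R[i],
    [/\ forall (c : R[i]) x y z,
          form ((c%:A : HH) *: x + y) z = c * form x z + form y z,
        forall x y, form y x = Num.conj (form x y),
        forall x, x != 0 -> 0 < form x x &
        forall (h : HH) x y, form (h *: x) y = form x (b h *: y)].

Section PrincipalSeries.
Variable nu : complexified V'.

(* The left ideal generated by the p - p(nu), p in S(V_C). *)
Definition char_ideal : {pred HH} := fun x : HH =>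
  `[< exists s : seq (HH * symalg V),
        x = \sum_(hp <- s) hp.1 * (theta hp.2 - (sym_eval rs nu hp.2)%:A) >].

Lemma char_idealM h x : x \in char_ideal -> h * x \in char_ideal.
Proof.
move=> /asboolP[s ->]; apply/asboolP; exists [seq (h * hp.1, hp.2) | hp <- s].
by rewrite big_map mulr_sumr; apply: eq_bigr => hp _; rewrite mulrA.
Qed.

Lemma char_ideal_zmod : zmod_closed char_ideal.
Proof.
split=> [|x y /asboolP[s ->] yI].
  by apply/asboolP; exists [::]; rewrite big_nil.
have /asboolP[s' e] := char_idealM (-1) yI.
by apply/asboolP; exists (s ++ s'); rewrite big_cat /= -e mulN1r.
Qed.

HB.instance Definition _ := GRing.isZmodClosed.Build HH char_ideal char_ideal_zmod.

(* H (x)_{S(V_C)} C_nu = H / char_ideal, with h (x) z the class of z h; see   *)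
(* the lemmas on tens below.                                                  *)
Definition principal_series : Type := Quotient.quot char_ideal.
HB.instance Definition _ := GRing.Zmodule.on principal_series.
HB.instance Definition _ := ZmodQuotient.on principal_series.

Local Open Scope quotient_scope.

Definition ps_class (h : HH) : principal_series := \pi h.

Lemma ps_classP h k : (ps_class h = ps_class k) <-> (h - k \in char_ideal).
Proof. by rewrite Quotient.idealrBE; split=> [e|/eqP //]; apply/eqP. Qed.

Lemma ps_classB : {morph ps_class : h k / h - k}.
Proof. exact: raddfB. Qed.

Lemma ps_classD : {morph ps_class : h k / h + k}.
Proof. exact: raddfD. Qed.

Lemma ps_class_surj x : exists h, x = ps_class h.
Proof. by exists (repr x); rewrite /ps_class reprK. Qed.

Definition ps_scale (h : HH) (x : principal_series) := ps_class (h * repr x).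

Lemma ps_scaleE h k : ps_scale h (ps_class k) = ps_class (h * k).
Proof.
apply/ps_classP; rewrite -mulrBr char_idealM //; apply/ps_classP.
by rewrite /ps_class reprK.
Qed.

Fact ps_scaleA g h x : ps_scale g (ps_scale h x) = ps_scale (g * h) x.
Proof. by have [k ->] := ps_class_surj x; rewrite !ps_scaleE mulrA. Qed.

Fact ps_scale1 : left_id 1 ps_scale.
Proof. by move=> x; have [k ->] := ps_class_surj x; rewrite ps_scaleE mul1r. Qed.

Fact ps_scaleDr : right_distributive ps_scale +%R.
Proof.
move=> h x y; have [k ->] := ps_class_surj x; have [l ->] := ps_class_surj y.
by rewrite -ps_classD !ps_scaleE mulrDr ps_classD.
Qed.

Fact ps_scaleDl x : {morph ps_scale^~ x : g h / g + h}.
Proof.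
by move=> g h; have [k ->] := ps_class_surj x; rewrite !ps_scaleE mulrDl ps_classD.
Qed.

HB.instance Definition _ := GRing.Zmodule_isLmodule.Build HH principal_series
  ps_scaleA ps_scale1 ps_scaleDr ps_scaleDl.

Definition tens (h : HH) (z : R[i]) : principal_series := ps_class (z *: h).

Lemma tens_Dl g h z : tens (g + h) z = tens g z + tens h z.
Proof. by rewrite /tens scalerDr ps_classD. Qed.

Lemma tens_Dr h y z : tens h (y + z) = tens h y + tens h z.
Proof. by rewrite /tens scalerDl ps_classD. Qed.

Lemma tens_balanced h p z : tens (h * theta p) z = tens h (sym_eval rs nu p * z).
Proof.
apply/ps_classP; apply/asboolP; exists [:: (z *: h, p)]; rewrite big_seq1 /=.
by rewrite mulrBr -!scalerAl -scalerAr mulr1 scalerA mulrC.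
Qed.

Lemma tens_action g h z : g *: tens h z = tens (g * h) z.
Proof. by rewrite [LHS]ps_scaleE /tens scalerAr. Qed.

Lemma tens_universal (A : zmodType) (f : HH -> R[i] -> A) :
    (forall g h z, f (g + h) z = f g z + f h z) ->
    (forall h y z, f h (y + z) = f h y + f h z) ->
    (forall h p z, f (h * theta p) z = f h (sym_eval rs nu p * z)) ->
  exists F : {additive principal_series -> A},
    (forall h z, F (tens h z) = f h z) /\
    forall G : {additive principal_series -> A},
      (forall h z, G (tens h z) = f h z) -> G =1 F.
Proof.
move=> fDl fDr fbal.
have f0 z : f 0 z = 0 by apply: (addrI (f 0 z)); rewrite -fDl !addr0.
have f0r h : f h 0 = 0 by apply: (addrI (f h 0)); rewrite -fDr !addr0.
have fN h z : f (- h) z = - f h z.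
  by apply: (addrI (f h z)); rewrite -fDl !subrr f0.
have fZ (c : R[i]) h z : f (c *: h) z = f h (c * z).
  have := fbal h c%:MP z; rewrite /sym_eval mevalC => <-.
  by rewrite -[c%:MP]mulr1 mul_mpolyC linearZ /= rmorph1 -scalerAr mulr1.
have f_eq h k : h - k \in char_ideal -> f h 1 = f k 1.
  move=> /asboolP[s e]; apply/eqP; rewrite -subr_eq0 -fN -fDl e; apply/eqP.
  elim: s {e} => [|hp s IHs]; first by rewrite big_nil.
  rewrite big_cons fDl IHs addr0 mulrBr fDl fbal fN -scalerAr fZ !mulr1.
  by rewrite subrr.
pose F0 (x : principal_series) := f (repr x) 1.
have F0E h : F0 (ps_class h) = f h 1.
  by apply: f_eq; apply/ps_classP; rewrite /ps_class reprK.
have F0B : zmod_morphism F0.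
  move=> x y; have [k ->] := ps_class_surj x; have [l ->] := ps_class_surj y.
  by rewrite -ps_classB !F0E fDl fN.
pose mF := GRing.isZmodMorphism.Build principal_series A F0 F0B.
pose F : {additive principal_series -> A} := HB.pack F0 mF.
exists F; split=> [h z|G GE x]; first by rewrite /= F0E fZ mulr1.
have [k ->] := ps_class_surj x.
by rewrite [RHS]F0E -GE /tens scale1r.
Qed.

End PrincipalSeries.

(* Y is a quotient, through f, of the submodule M of X. *)
Definition subquotient (X Y : lmodType HH) : Prop :=
  exists (M : {pred X}) (f : X -> Y),
    [/\ submod_closed M,
        {in M &, forall x y, forall h : HH, f (h *: x + y) = h *: f x + f y} &
        forall y, exists2 x, x \in M & f x = y].

Definition irreducible (X : lmodType HH) : Prop :=
  (exists x : X, x != 0) /\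
  forall S : {pred X}, submod_closed S ->
    (forall x, x \in S -> x = 0) \/ (forall x, x \in S).

(* Hom_W[triv, X] != 0 *)
Definition spherical (X : lmodType HH) : Prop :=
  exists f : R[i] -> X,
    [/\ forall c y z, f (c * y + z) = (c%:A : HH) *: f y + f z,
        forall w z, weyl_group rs w -> t w *: f z = f z &
        exists z, f z != 0].

Definition spherical_subquotient (nu : complexified V') (X : lmodType HH) : Prop :=
  [/\ subquotient (principal_series nu) X, irreducible X & spherical X].

End Hecke.

Section Chamber.
Context (R : realType) (V V' : vectType R) (rs : root_system V V') (Pi : seq V).

Definition dominant (nu : complexified V') : Prop :=
  forall a, a \in Pi -> 0 <= pairing rs a (re_part nu).

Definition C_infty : set V' :=
  [set l | forall a, a \in Pi -> 1 < pairing rs a l]%classic.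

End Chamber.

(* Closure for the Euclidean topology of a finite-dimensional real space,     *)
(* transported along coordinates.                                             *)
Definition vclosure (R : realType) (U : vectType R) (A : set U) : set U :=
  (passmx.rVof (vbasis {: U}) @^-1`
     closure (passmx.rVof (vbasis {: U}) @` A))%classic.

(* Main.v *)
From HB Require Import structures.
From mathcomp Require Import all_boot all_order all_algebra.
From mathcomp Require Import complex boolp classical_sets reals topology.
From mathcomp Require Import mpoly.
From mathcomp Require Import ring lra.
Require Import Defs.

Set Implicit Arguments.
Unset Strict Implicit.
Unset Printing Implicit Defensive.

Import Order.TTheory GRing.Theory Num.Theory.
Import numFieldTopology.Exports.

Local Open Scope ring_scope.
Local Open Scope complex_scope.

(** The commutative subalgebra $S(V_{\mathbb C})$ acts on $X(\nu)$, hence on $\overline X=\overline X(\nu)$, through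
    generalized weights in the orbit $W\nu$ (principal_series_finite), so
    $\overline X$ has a weight vector.  On a unitary module every $v\in V$ is
    self-adjoint, so all weights are real; as they are images of $\nu$, this
    forces $\operatorname{Im}\nu=0$ (unitary_real).

    Now let $\nu$ be real and dominant.  From a vector y of weight $\lambda$ with
    $n=(\alpha,\lambda)\ne0$ the intertwiner produces $t_\alpha y-y/n$, of weight
    $s_\alpha\lambda$.  When $n<0$ it does not kill y: otherwise $t_\alpha y=-y$,
    and the symmetrizer over $W$ would vanish on $\mathbb Hy=\overline X$, which
    contains a $W$-fixed vector (spherical_no_sign).  So weights can be moved
    towards the dominant chamber, and because $\nu$ is the only dominant point
    of its orbit, $\overline X$ has a vector x of weight exactly $\nu$
    (dominant_weight_vector).

    Necessity.  Let $n=(\alpha,\nu)\ge0$.  If $n>0$, orthogonality of x and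
    $t_\alpha x-x/n$ gives $(t_\alpha x,x)=|x|^2/n$, while $t_\alpha$ is an isometry;
    so $n\ge1$.  If $n=0$ then $\alpha$ would act on the span of x and
    $t_\alpha x$ as a nonzero nilpotent operator, although it is self-adjoint
    (unitary_ge1).

    Sufficiency.  If $(\alpha,\nu)\ge1$ for all simple $\alpha$, then
    $(\beta,\nu)\ge1$ for all positive roots $\beta$ (positive_pairing_ge1), so
    $\nu$ is regular and $\overline X$ is the direct sum of its weight spaces.
    Let $\phi(h)$ be the coefficient of x in hx.  A functional on $\mathbb H$
    that vanishes on the left and right multiples of all $v-(v,\nu)$ is
    determined by its value at 1 (hecke_bimodule_ind), whence
    $\phi(h^\bullet)=\overline{\phi(h)}$.  So
    $\langle hx,kx\rangle=\phi(k^\bullet h)$ is a well defined invariant hermitian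
    form.  Distinct weights are orthogonal, and the intertwiners multiply
    squared norms by $1-n^{-2}\ge0$; bringing a weight vector to the line of x by
    intertwiners that do not kill it shows that its squared norm is positive. *)

(** * Root systems *)

Section RootSystem.
Context (R : realType) (V V' : vectType R) (rs : root_system V V').

Local Notation s := (reflection rs).
Local Notation "<< v , l >>" := (pairing rs v l) (at level 0, v at level 99).
Local Notation "a ^v" := (coroot rs a) (at level 2, format "a ^v").

Lemma pairingDl u v l : <<u + v, l>> = <<u, l>> + <<v, l>>.
Proof. by rewrite -{1}[u]scale1r pairing_linl mul1r. Qed.

Lemma pairing0l l : <<0, l>> = 0.
Proof. by apply: (addrI <<0, l>>); rewrite -pairingDl !addr0. Qed.

Lemma pairingZl c v l : <<c *: v, l>> = c * <<v, l>>.
Proof. by rewrite -{1}[_ *: _]addr0 pairing_linl pairing0l addr0. Qed.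

Lemma pairingNl v l : <<- v, l>> = - <<v, l>>.
Proof. by rewrite -scaleN1r pairingZl mulN1r. Qed.

Lemma pairingBl u v l : <<u - v, l>> = <<u, l>> - <<v, l>>.
Proof. by rewrite pairingDl pairingNl. Qed.

Lemma pairingDr v l m : <<v, l + m>> = <<v, l>> + <<v, m>>.
Proof. by rewrite -{1}[l]scale1r pairing_linr mul1r. Qed.

Lemma pairing0r v : <<v, 0>> = 0.
Proof. by apply: (addrI <<v, 0>>); rewrite -pairingDr !addr0. Qed.

Lemma pairingZr c v l : <<v, c *: l>> = c * <<v, l>>.
Proof. by rewrite -{1}[_ *: _]addr0 pairing_linr pairing0r addr0. Qed.

Lemma pairingBr v l m : <<v, l - m>> = <<v, l>> - <<v, m>>.
Proof. by rewrite pairingDr -scaleN1r pairingZr mulN1r. Qed.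

Lemma pairing_suml (I : Type) (r : seq I) (F : I -> V) l :
  <<\sum_(i <- r) F i, l>> = \sum_(i <- r) <<F i, l>>.
Proof.
by elim: r => [|i r IH]; rewrite ?big_nil ?pairing0l // !big_cons pairingDl IH.
Qed.

Lemma lfunBZ (f : 'End(V)) u c v : f (u - c *: v) = f u - c *: f v.
Proof. by rewrite linearB /= (linearZ_LR f). Qed.

Lemma reflection_root a : a \in roots rs -> s a a = - a.
Proof.
by move=> aR; rewrite reflectionE pairing_coroot // mulr2n scalerDl scale1r
  opprD addrA subrr add0r.
Qed.

Lemma reflectionK a : a \in roots rs -> involutive (s a).
Proof.
move=> aR v; rewrite [X in s a X]reflectionE linearB linearZ /=.
by rewrite reflection_root // reflectionE scalerN opprK subrK.
Qed.

Lemma reflection_comp2 a : a \in roots rs -> (s a \o s a)%VF = \1%VF.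
Proof. by move=> aR; apply/lfunP=> v; rewrite !lfunE /= reflectionK. Qed.

Lemma reflection_inv a : a \in roots rs -> (s a)^-1%VF = s a.
Proof.
move=> aR; have k0 : lker (s a) == 0%VS.
  by apply/lker0P; apply: can_inj (reflectionK aR).
rewrite -[LHS]comp_lfun1r -(reflection_comp2 aR) comp_lfunA.
by rewrite lker0_compVf // comp_lfun1l.
Qed.

Lemma weyl_reflection a : a \in roots rs -> weyl_group rs (s a).
Proof.
by move=> aR; rewrite -[s a]comp_lfun1r; do 2!constructor=> //.
Qed.

Lemma weyl_groupC u w : weyl_group rs u -> weyl_group rs w ->
  weyl_group rs (u \o w)%VF.
Proof.
elim=> [|a u' aR _ IH] wW; first by rewrite comp_lfun1l.
by rewrite -comp_lfunA; constructor=> //; apply: IH.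
Qed.

Lemma weyl_inv w : weyl_group rs w ->
  exists2 w', weyl_group rs w' & (w \o w')%VF = \1%VF /\ (w' \o w)%VF = \1%VF.
Proof.
elim=> [|a u aR _ [u' u'W [e1 e2]]].
  by exists \1%VF; [constructor|rewrite comp_lfun1l].
exists (u' \o s a)%VF.
  by apply: weyl_groupC => //; apply: weyl_reflection.
rewrite -!comp_lfunA (comp_lfunA u u') e1 comp_lfun1l reflection_comp2 //.
by rewrite (comp_lfunA (s a)) reflection_comp2 // comp_lfun1l e2.
Qed.

Lemma weyl_roots w b : weyl_group rs w -> b \in roots rs -> w b \in roots rs.
Proof.
move=> wW bR; elim: wW => [|a u aR _ IH]; first by rewrite lfunE.
by rewrite comp_lfunE reflectionE roots_refl.
Qed.

Lemma root_neq0 a : a \in roots rs -> a != 0.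
Proof.
move=> aR; apply/eqP=> a0; have := pairing_coroot aR.
by rewrite a0 pairing0l => /eqP; rewrite eq_sym pnatr_eq0.
Qed.

Lemma oppr_root a : a \in roots rs -> - a \in roots rs.
Proof. by move=> aR; rewrite -reflection_root // reflectionE roots_refl. Qed.

(** A $W$-invariant form on $V$ that sees the roots as vectors of positive
    length.  It expresses every coroot in terms of its root, which is how
    reflections are shown to be permuted by conjugation although nothing says
    a priori that the bijection between roots and coroots is equivariant. *)
Definition coform v w :=
  \sum_(d <- undup (map (coroot rs) (roots rs))) <<v, d>> * <<w, d>>.

Lemma coformC v w : coform v w = coform w v.
Proof. by apply: eq_bigr => d _; rewrite mulrC. Qed.

Lemma coformDl u v w : coform (u + v) w = coform u w + coform v w.
Proof.
by rewrite -big_split; apply: eq_bigr => d _; rewrite pairingDl mulrDl.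
Qed.

Lemma coformZl c v w : coform (c *: v) w = c * coform v w.
Proof.
by rewrite mulr_sumr; apply: eq_bigr => d _; rewrite pairingZl mulrA.
Qed.

Lemma coform_suml (I : Type) (r : seq I) (F : I -> V) w :
  coform (\sum_(i <- r) F i) w = \sum_(i <- r) coform (F i) w.
Proof.
elim: r => [|i r IH]; last by rewrite !big_cons coformDl IH.
by rewrite !big_nil -(scale0r 0) coformZl mul0r.
Qed.

Lemma coform_reflection a v w : a \in roots rs ->
  coform (s a v) (s a w) = coform v w.
Proof.
move=> aR; pose f d := d - <<a, d>> *: a^v.
pose D := undup (map (coroot rs) (roots rs)).
have fK : involutive f.
  move=> d; rewrite /f pairingBr pairingZr pairing_coroot //.
  rewrite mulr_natr mulr2n opprD addNKr scaleNr opprK.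
  by rewrite subrK.
have fD d : d \in D -> f d \in D.
  rewrite !mem_undup => /mapP[b bR ->]; exact: coroots_refl.
have pD : perm_eq (map f D) D.
  apply: uniq_perm; rewrite ?undup_uniq ?map_inj_uniq ?undup_uniq //.
    exact: inv_inj.
  move=> d; apply/mapP/idP => [[e eD ->]|dD]; first exact: fD.
  by exists (f d); rewrite ?fK ?fD.
have sE u d : <<s a u, d>> = <<u, f d>>.
  rewrite reflectionE pairingBl pairingZl /f pairingBr pairingZr.
  by rewrite (mulrC <<a, d>>).
rewrite /coform -/D -[in RHS](perm_big _ pD) big_map /=.
by apply: eq_bigr => d _; rewrite !sE.
Qed.

Lemma coform_coroot a v : a \in roots rs ->
  2 * coform v a = <<v, a^v>> * coform a a.
Proof.
move=> aR; have := coform_reflection v a aR; rewrite reflection_root //.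
rewrite reflectionE coformC -scaleN1r coformZl coformC coformDl.
rewrite -scaleNr coformZl; lra.
Qed.

Lemma coform_gt0 a : a \in roots rs -> 0 < coform a a.
Proof.
move=> aR; rewrite /coform (bigD1_seq a^v) ?undup_uniq //=; last first.
  by rewrite mem_undup map_f.
rewrite ltr_wpDr //; first by apply: sumr_ge0 => d _; rewrite -expr2 sqr_ge0.
by rewrite pairing_coroot // mulr_gt0.
Qed.

Lemma pairing_coroot_reflection a b v : a \in roots rs -> b \in roots rs ->
  <<s a v, (s a b)^v>> = <<v, b^v>>.
Proof.
move=> aR bR; have sR : s a b \in roots rs by rewrite reflectionE roots_refl.
have := coform_coroot (s a v) sR.
rewrite !coform_reflection // coform_coroot //.
by move=> /mulIf-> //; rewrite gt_eqF // coform_gt0.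
Qed.

Lemma reflection_conj w b : weyl_group rs w -> b \in roots rs ->
  (s (w b) \o w)%VF = (w \o s b)%VF.
Proof.
move=> wW bR; elim: wW => [|a u aR uW IH].
  by rewrite lfunE /= comp_lfun1l comp_lfun1r.
rewrite -comp_lfunA -IH !comp_lfunA; congr (_ \o _)%VF.
apply/lfunP=> v; rewrite !comp_lfunE (reflectionE _ _ (s a v)).
rewrite pairing_coroot_reflection ?weyl_roots //.
by rewrite (reflectionE _ (u b)) lfunBZ.
Qed.

(** * Positive roots *)

Context (Pi : seq V) (Pi_simple : simple_roots rs Pi).

Lemma simple_root a : a \in Pi -> a \in roots rs.
Proof. by case: Pi_simple => sub _ _ /sub. Qed.

Definition positive b := b \in roots rs /\
  exists c : V -> R, (forall a, a \in Pi -> 0 <= c a) /\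
    b = \sum_(a <- Pi) c a *: a.

Lemma positive_root b : positive b -> b \in roots rs. Proof. by case. Qed.

Lemma simple_comb0 (c : V -> R) :
  \sum_(a <- Pi) c a *: a = 0 -> forall a, a \in Pi -> c a = 0.
Proof.
case: Pi_simple => _ fPi _ c0 a aPi.
have fP := elimT (freeP (X := in_tuple Pi)) fPi.
have ai : (index a Pi < size Pi)%N by rewrite index_mem.
have := fP (fun i => c Pi`_i) _ (Ordinal ai); rewrite /= nth_index //.
by apply; rewrite -[RHS]c0 (big_nth 0) big_mkord.
Qed.

Lemma simple_comb_inj (c d : V -> R) :
  \sum_(a <- Pi) c a *: a = \sum_(a <- Pi) d a *: a ->
  forall a, a \in Pi -> c a = d a.
Proof.
move=> e a aPi; apply/eqP; rewrite -subr_eq0; apply/eqP.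
apply: (simple_comb0 (c := fun a => c a - d a)) => //.
under eq_bigr do rewrite scalerBl.
by rewrite sumrB e subrr.
Qed.

Lemma simple_uniq : uniq Pi.
Proof. by case: Pi_simple => _ /free_uniq. Qed.

Lemma simple_comb1 a : a \in Pi -> a = \sum_(b <- Pi) (b == a)%:R *: b.
Proof.
move=> aPi; rewrite (bigD1_seq a) ?simple_uniq //= eqxx scale1r big1 ?addr0 //.
by move=> b /negbTE->; rewrite scale0r.
Qed.

Lemma positive_simple a : a \in Pi -> positive a.
Proof.
move=> aPi; split; first exact: simple_root.
exists (fun b => (b == a)%:R).
by split=> [b _|]; rewrite ?ler0n // -simple_comb1.
Qed.

Lemma root_sign b : b \in roots rs -> positive b \/ positive (- b).
Proof.
move=> bR; case: Pi_simple => _ _ /(_ b bR) [c [c0 [e|e]]].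
  by left; split=> //; exists c.
by right; split; [exact: oppr_root|exists c; rewrite {1}e opprK].
Qed.

Lemma positiveN b : positive b -> ~ positive (- b).
Proof.
move=> [bR [c [c0 ce]]] [_ [d [d0 de]]].
have cd a : a \in Pi -> c a = - d a.
  apply: (simple_comb_inj (d := fun a => - d a)).
  by under [RHS]eq_bigr do rewrite scaleNr; rewrite sumrN -ce -de opprK.
have := root_neq0 bR; rewrite ce big_seq big1 ?eqxx // => a aPi.
suff -> : c a = 0 by rewrite scale0r.
by move: (cd a aPi) (c0 a aPi) (d0 a aPi); lra.
Qed.

(** Subtracting a multiple of $\alpha$ leaves the other coefficients alone, and
    a positive root other than $\alpha$ has one of them positive because the
    system is reduced. *)
Lemma positive_reflection a b : a \in Pi -> positive b -> b != a ->
  positive (s a b).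
Proof.
move=> aPi [bR [c [c0 ce]]] nba; have aR := simple_root aPi.
have sR : s a b \in roots rs by rewrite reflectionE roots_refl.
have [//|[_ [d [d0 de]]]] := root_sign sR.
exfalso; suff cz g : g \in Pi -> g != a -> c g = 0.
  have ba : b = c a *: a.
    rewrite {1}ce (bigD1_seq a) ?simple_uniq //= big1_seq ?addr0 // => g.
    by move=> /andP[ga gPi]; rewrite cz ?scale0r.
  have caR : c a *: a \in roots rs by rewrite -ba.
  have [c1|c1] := roots_reduced aR caR.
    by move: nba; rewrite ba c1 scale1r eqxx.
  by have := c0 a aPi; rewrite c1; lra.
move=> gPi ga.
have cd : c g - <<b, a^v>> * (g == a)%:R = - d g.
  pose e g := c g - <<b, a^v>> * (g == a)%:R.
  apply: (simple_comb_inj (c := e) (d := fun g => - d g)) => //.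
  under eq_bigr do rewrite /e scalerBl -scalerA.
  rewrite sumrB -ce -scaler_sumr -simple_comb1 //.
  under eq_bigr do rewrite scaleNr.
  by rewrite sumrN -de opprK reflectionE.
move: cd (c0 g gPi) (d0 g gPi); rewrite (negbTE ga) mulr0; lra.
Qed.

Lemma seq_descent (T : eqType) (r : seq T) (f : T -> R) (P : T -> Prop) :
    (forall x, x \in r -> (forall y, y \in r -> f y < f x -> P y) -> P x) ->
  forall x, x \in r -> P x.
Proof.
move=> step x; have [n] := ubnP (count (fun y => f y < f x) r).
elim: n x => // n IH x; rewrite ltnS => xn xr; apply: step => // y yr yx.
apply: IH => //; apply: leq_trans xn.
have /permP cE := perm_to_rem yr; rewrite !cE /= ltxx yx add0n ltnS.
by apply: sub_count => z /= /lt_trans->.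
Qed.

(** Induction on the height: as coform b b > 0, some simple root
    $\alpha$ occurring in b has $(b,\alpha^\vee)>0$, so its reflection lowers b. *)
Lemma positive_ind (P : V -> Prop) :
    (forall a, a \in Pi -> P a) ->
    (forall a b, a \in Pi -> positive b -> 0 < <<b, a^v>> ->
       positive (s a b) -> P (s a b) -> P b) ->
  forall b, positive b -> P b.
Proof.
move=> P1 PS b0 b0pos.
pose cf (b a : V) : R := if insub (index a Pi) is Some i
  then coord (in_tuple Pi) i b else 0.
pose ht b : R := \sum_(a <- Pi) cf b a.
have cfB a u v c : cf (u - c *: v) a = cf u a - c * cf v a.
  rewrite /cf; case: insubP => [i _ _|_]; last by rewrite mulr0 subrr.
  by rewrite linearB linearZ.
have cf1 a b : a \in Pi -> b \in Pi -> cf a b = (b == a)%:R.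
  move=> aPi bPi; rewrite /cf.
  case: insubP => [i _ iE|]; last by rewrite index_mem bPi.
  have ai : (index a Pi < size Pi)%N by rewrite index_mem.
  have aE : a = (in_tuple Pi)`_(Ordinal ai) by rewrite /= nth_index.
  case: Pi_simple => _ fPi _; rewrite [in LHS]aE coord_free // -val_eqE /= iE.
  congr (nat_of_bool _)%:R; apply/eqP/eqP=> [/(congr1 (nth 0 Pi))|-> //].
  by rewrite !nth_index.
have ht1 a : a \in Pi -> ht a = 1.
  move=> aPi; rewrite /ht (bigD1_seq a) ?simple_uniq //= cf1 // eqxx.
  rewrite big1_seq ?addr0 // => c /andP[ca cPi].
  by rewrite cf1 // (negbTE ca).
have htB u v c : ht (u - c *: v) = ht u - c * ht v.
  rewrite /ht; under eq_bigr do rewrite cfB.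
  by rewrite sumrB mulr_sumr.
have b0R := positive_root b0pos; move: b0 b0R b0pos.
apply: (seq_descent (f := ht)) => b bR IH bpos.
have [bPi|nbPi] := boolP (b \in Pi); first exact: P1.
have [a aPi ab] : exists2 a, a \in Pi & 0 < <<b, a^v>>.
  apply: contrapT => nP; have := coform_gt0 bR.
  have [_ [c [c0 ce]]] := bpos.
  rewrite {1}ce coform_suml big_seq ltNge => /negP; apply.
  apply: sumr_le0 => a aPi; have aR := simple_root aPi.
  rewrite coformZl mulr_ge0_le0 ?c0 //.
  rewrite -(pmulr_rle0 _ (ltr0n R 2)) coformC coform_coroot //.
  rewrite mulr_le0_ge0 //; last exact/ltW/coform_gt0.
  by rewrite leNgt; apply/negP=> ?; apply: nP; exists a.
have spos : positive (s a b).
  by apply: positive_reflection => //; apply: contraNneq nbPi => ->.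
apply: (PS a) => //; apply: IH => //; first exact: positive_root.
by rewrite reflectionE htB (ht1 a) // mulr1 ltrBlDr ltrDl.
Qed.

(** * Words in the simple reflections *)

(** word_op [:: a1; ..; ak] is $s_{a_k}\cdots s_{a_1}$, the inverse of the product
    $s_{a_1}\cdots s_{a_k}$ read along the word: this is the operator through
    which $t_{a_1}\cdots t_{a_k}$ moves weights. *)
Definition word_op (ws : seq V) : 'End(V) :=
  foldr (fun a u => (u \o s a)%VF) \1%VF ws.

Lemma word_op_cat ws1 ws2 :
  word_op (ws1 ++ ws2) = (word_op ws2 \o word_op ws1)%VF.
Proof.
elim: ws1 => [|a ws IH] /=; first by rewrite comp_lfun1r.
by rewrite IH comp_lfunA.
Qed.

Lemma word_op_rcons ws b : word_op (rcons ws b) = (s b \o word_op ws)%VF.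
Proof. by rewrite -cats1 word_op_cat /= comp_lfun1l. Qed.

Lemma word_op_rev ws : {subset ws <= Pi} ->
  (word_op ws \o word_op (rev ws))%VF = \1%VF.
Proof.
elim: ws => [|a ws IH] sub /=; first by rewrite comp_lfun1l.
rewrite rev_cons word_op_rcons -comp_lfunA (comp_lfunA (s a)).
rewrite reflection_comp2 ?comp_lfun1l ?IH // => [b bws|].
  by apply: sub; rewrite inE bws orbT.
by apply/simple_root/sub; rewrite inE eqxx.
Qed.

Lemma weyl_word ws : {subset ws <= Pi} -> weyl_group rs (word_op ws).
Proof.
elim: ws => [|a ws IH] sub /=; first by constructor.
apply: weyl_groupC.
  by apply: IH => b bws; apply: sub; rewrite inE bws orbT.
by apply/weyl_reflection/simple_root/sub; rewrite inE eqxx.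
Qed.

Lemma subset_rcons (b : V) ws :
  {subset rcons ws b <= Pi} <-> {subset ws <= Pi} /\ b \in Pi.
Proof.
split=> [sub|[sub bPi] c].
  by split=> [c cws|]; apply: sub; rewrite mem_rcons inE ?eqxx ?cws ?orbT.
by rewrite mem_rcons inE => /orP[/eqP->|/sub].
Qed.

Lemma subset_cons (b : V) ws :
  {subset b :: ws <= Pi} <-> b \in Pi /\ {subset ws <= Pi}.
Proof.
split=> [sub|[bPi sub] c].
  by split=> [|c cws]; apply: sub; rewrite inE ?eqxx ?cws ?orbT.
by rewrite inE => /orP[/eqP->|/sub].
Qed.

(** The simple reflections generate: by induction on the height every root is
    a simple root moved by a word, hence its reflection is conjugate to a
    simple reflection. *)
Lemma weyl_wordP w : weyl_group rs w ->
  exists2 ws, {subset ws <= Pi} & w = word_op ws.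
Proof.
have refl b : positive b -> exists2 ws, {subset ws <= Pi} & s b = word_op ws.
  elim/positive_ind => [a aPi|a b' aPi bpos _ _ [ws sub e]].
    exists [:: a]; last by rewrite /= comp_lfun1l.
    by move=> b'; rewrite inE => /eqP->.
  have aR := simple_root aPi; have bR := positive_root bpos.
  exists (rcons (a :: ws) a).
    by apply/subset_rcons; split=> //; apply/subset_cons.
  rewrite word_op_rcons /= -e reflection_conj //; last exact: weyl_reflection.
  by rewrite comp_lfunA reflection_comp2 ?comp_lfun1l.
elim=> [|a u aR _ [ws sub ->]]; first by exists [::].
have [ws1 sub1 e] : exists2 ws, {subset ws <= Pi} & s a = word_op ws.
  have [/refl //|/refl [ws1 sub1 e]] := root_sign aR.
  exists ws1 => //; rewrite -e.
  have /(congr1 (fun f => (f \o s a)%VF)) :=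
    reflection_conj (weyl_reflection aR) aR.
  by rewrite reflection_root // -!comp_lfunA reflection_comp2 // !comp_lfun1r.
exists (ws ++ ws1); last by rewrite word_op_cat e.
by move=> c; rewrite mem_cat => /orP[/sub|/sub1].
Qed.

(** Exchange: follow $\alpha$ along the word.  The letter that turns its image
    negative equals that image, so it is the conjugate of $s_\alpha$ by the part
    of the word already read, and it cancels. *)
Lemma exchange ws a :
    {subset ws <= Pi} -> a \in Pi -> positive (- word_op ws a) ->
  exists ws', [/\ {subset ws' <= Pi}, size ws = (size ws').+1 &
    (word_op ws \o s a)%VF = word_op ws'].
Proof.
elim/last_ind: ws => [|ws b IH] sub aPi.
  by rewrite lfunE /= => /positiveN[]; rewrite opprK; apply: positive_simple.
move: sub => /subset_rcons[sub bPi]; rewrite word_op_rcons lfunE /= => neg.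
have wR : word_op ws a \in roots rs.
  by apply: weyl_roots (weyl_word sub) (simple_root aPi).
have [pos|neg'] := root_sign wR; last first.
  have [ws' [sub' sz e]] := IH sub aPi neg'; exists (rcons ws' b); split.
  - exact/subset_rcons.
  - by rewrite !size_rcons sz.
  - by rewrite -comp_lfunA e word_op_rcons.
have [wb|nb] := eqVneq (word_op ws a) b; last first.
  by have := positiveN (positive_reflection bPi pos nb).
exists ws; split=> //; first by rewrite size_rcons.
rewrite -comp_lfunA -(reflection_conj (weyl_word sub) (simple_root aPi)) wb.
by rewrite comp_lfunA reflection_comp2 ?comp_lfun1l // simple_root.
Qed.

Lemma positive_pairing_ge0 l b : (forall a, a \in Pi -> 0 <= <<a, l>>) ->
  positive b -> 0 <= <<b, l>>.
Proof.
move=> dom [_ [c [c0 ->]]]; rewrite pairing_suml big_seq.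
by apply: sumr_ge0 => a aPi; rewrite pairingZl mulr_ge0 ?c0 ?dom.
Qed.

(** Height induction again: reflecting down only subtracts nonnegative terms. *)
Lemma positive_pairing_ge1 l b : (forall a, a \in Pi -> 1 <= <<a, l>>) ->
  positive b -> 1 <= <<b, l>>.
Proof.
move=> dom; elim/positive_ind=> // a b' aPi _ ba _.
rewrite reflectionE pairingBl pairingZl => h.
have := mulr_ge0 (ltW ba) (le_trans ler01 (dom a aPi)); lra.
Qed.

Lemma pairing_word_reflection ws a v l :
  <<(word_op ws \o s a)%VF v, l>> =
  <<word_op ws v, l>> - <<v, a^v>> * <<word_op ws a, l>>.
Proof. by rewrite lfunE /= reflectionE lfunBZ pairingBl pairingZl. Qed.

(** Induction on the word $a\,w$.  If the rest of the word makes a negative,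
    exchange gives a shorter word for the same operator.  Otherwise the
    pairing of its image of a with l has both signs, hence vanishes, and the
    letter a can be dropped. *)
Lemma dominant_unique ws l : {subset ws <= Pi} ->
    (forall a, a \in Pi -> 0 <= <<a, l>>) ->
    (forall a, a \in Pi -> 0 <= <<word_op ws a, l>>) ->
  forall v, <<word_op ws v, l>> = <<v, l>>.
Proof.
move=> sub dom; have [n] := ubnP (size ws).
elim: n ws sub => // n IH [|a ws]; first by move=> _ _ _ v; rewrite lfunE.
move=> /subset_cons[aPi sub]; rewrite /= ltnS => szn domw v.
have aR := simple_root aPi.
have wR : word_op ws a \in roots rs by apply: weyl_roots (weyl_word sub) aR.
have [pos|neg] := root_sign wR; last first.
  have [ws' [sub' sz e]] := exchange sub aPi neg.
  rewrite e; apply: IH => //; first by rewrite -ltnS -sz ltnS ltnW.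
  by move=> b bPi; rewrite -e domw.
have a0 : <<word_op ws a, l>> = 0.
  have := domw a aPi; rewrite pairing_word_reflection pairing_coroot //.
  by have := positive_pairing_ge0 dom pos; lra.
have wE u : <<(word_op ws \o s a)%VF u, l>> = <<word_op ws u, l>>.
  by rewrite pairing_word_reflection a0 mulr0 subr0.
by rewrite wE IH // => b bPi; rewrite -wE domw.
Qed.

(** A nonempty word either makes its first letter negative or, by exchange, can
    be shortened. *)
Lemma word_op_positive ws : {subset ws <= Pi} ->
  (forall a, a \in Pi -> positive (word_op ws a)) -> word_op ws = \1%VF.
Proof.
have [n] := ubnP (size ws).
elim: n ws => // n IH [|a ws] //.
move=> szn /subset_cons[aPi sub] posw; have aR := simple_root aPi.
have wR : word_op ws a \in roots rs by apply: weyl_roots (weyl_word sub) aR.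
have [pos|neg] := root_sign wR.
  have := posw a aPi; rewrite /= lfunE /= reflection_root // linearN /=.
  by move=> /positiveN; rewrite opprK.
have [ws' [sub' sz e]] := exchange sub aPi neg.
move: posw szn; rewrite /= e sz ltnS => posw szn; apply: IH => //.
exact: ltnW.
Qed.

(** An operator fixing l as a functional preserves the sign of $(b,l)$, that is,
    the positivity of roots. *)
Lemma regular_stabilizer ws l : {subset ws <= Pi} ->
    (forall b, positive b -> 0 < <<b, l>>) ->
    (forall v, <<word_op ws v, l>> = <<v, l>>) ->
  word_op ws = \1%VF.
Proof.
move=> sub dom fix_l; apply: word_op_positive => // a aPi.
have wR : word_op ws a \in roots rs.
  by apply: weyl_roots (weyl_word sub) (simple_root aPi).
have [//|/dom] := root_sign wR; rewrite pairingNl fix_l.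
by have := dom a (positive_simple aPi); lra.
Qed.

(** The list over which one can symmetrize.  An element of $W$ is determined by
    the roots to which it sends the simple ones. *)
Lemma weyl_finite : exists Ws : seq 'End(V),
  uniq Ws /\ forall w : 'End(V), w \in Ws <-> weyl_group rs w.
Proof.
pose F := {ffun 'I_(size Pi) -> 'I_(size (roots rs))}.
pose Q (f : F) u := weyl_group rs u /\
  forall i : 'I_(size Pi), u Pi`_i = (roots rs)`_(f i).
have pickP (f : F) : {u | weyl_group rs u & (exists u, Q f u) -> Q f u}.
  have [ex|nex] := pselect (exists u, Q f u).
    by have [u Qu] := cid ex; exists u; [case: Qu|].
  by exists \1%VF; [constructor|].
pose pick f := s2val (pickP f).
exists (undup [seq pick f | f <- enum {: F}]); split; first exact: undup_uniq.
move=> w; rewrite mem_undup; split=> [/mapP[f _ ->]|wW]; first exact: s2valP.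
have idx (i : 'I_(size Pi)) :
    (index (w (nth 0%R Pi i)) (roots rs) < size (roots rs))%N.
  by rewrite index_mem weyl_roots // simple_root // mem_nth.
pose f : F := [ffun i => Ordinal (idx i)].
have Qw : Q f w.
  by split=> // i; rewrite ffunE /= nth_index // -index_mem.
have [uW uE] : Q f (pick f) by apply: (s2valP' (pickP f)); exists w.
suff -> : w = pick f by apply: map_f; rewrite mem_enum.
have [u' u'W [e1 e2]] := weyl_inv uW.
have [ws sub wsE] := weyl_wordP (weyl_groupC u'W wW).
have ws1 : word_op ws = \1%VF.
  apply: word_op_positive => // a aPi; rewrite -wsE lfunE /=.
  have ai : (index a Pi < size Pi)%N by rewrite index_mem.
  have := Qw.2 (Ordinal ai); rewrite -uE /= nth_index // => ->.
  rewrite -comp_lfunE e2 id_lfunE; exact: positive_simple.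
by rewrite -[LHS]comp_lfun1l -e1 -comp_lfunA wsE ws1 comp_lfun1r.
Qed.

End RootSystem.

(** * Weights, and the crossing relation in modules *)

Section SymAct.
Context (R : realType) (V V' : vectType R) (rs : root_system V V').
Implicit Types (u w : 'End(V)) (p q : symalg V).

Lemma symalg_ind (P : symalg V -> Prop) :
    (forall c, P c%:MP) -> (forall v, P (sym_of v)) ->
    (forall p q, P p -> P q -> P (p + q)) ->
    (forall p q, P p -> P q -> P (p * q)) ->
  forall p, P p.
Proof.
move=> PC PV PD PM; elim/mpolyind => [|c m p _ _ IH]; first by rewrite -mpolyC0.
apply: (PD) => //; rewrite -mul_mpolyC; apply: (PM) => //.
rewrite mpolyXE_id.
elim/big_ind: _ => [||i _]; [by rewrite -mpolyC1|exact: PM|].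
elim: (m i) => [|k IHk]; first by rewrite expr0 -mpolyC1.
by rewrite exprS; apply: (PM) => //; rewrite -sym_of_basis.
Qed.

(** Equality of ring morphisms is reduced to V once and for all; in this form
    it applies to abstract f and g, whose values never get computed. *)
Lemma symalg_morph_eq (A : pzRingType) (f g : symalg V -> A) :
    (forall c, f c%:MP = g c%:MP) -> (forall v, f (sym_of v) = g (sym_of v)) ->
    {morph f : p q / p + q} -> {morph g : p q / p + q} ->
    {morph f : p q / p * q} -> {morph g : p q / p * q} ->
  f =1 g.
Proof.
move=> fgC fgV fD gD fM gM; elim/symalg_ind=> // p q ep eq.
  by rewrite fD gD ep eq.
by rewrite fM gM ep eq.
Qed.

Lemma sym_of0 : sym_of (0 : V) = 0.
Proof.
have := sym_of_linear (-1) (0 : V) 0.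
by rewrite scaler0 addr0 rmorphN1 scaleN1r addNr.
Qed.

Lemma sym_ofN (v : V) : sym_of (- v) = - sym_of v.
Proof.
rewrite -scaleN1r -[_ *: v]addr0 sym_of_linear sym_of0 addr0.
by rewrite rmorphN1 scaleN1r.
Qed.

Lemma sym_of_sum (I : Type) (r : seq I) (c : I -> R) (F : I -> V) :
  sym_of (\sum_(i <- r) c i *: F i) = \sum_(i <- r) (c i)%:C *: sym_of (F i).
Proof.
elim: r => [|i r IH]; last by rewrite !big_cons sym_of_linear IH.
by rewrite !big_nil sym_of0.
Qed.

Lemma sym_actD w p q : sym_act w (p + q) = sym_act w p + sym_act w q.
Proof. by rewrite /sym_act comp_mpolyD. Qed.

Lemma sym_actM w p q : sym_act w (p * q) = sym_act w p * sym_act w q.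
Proof. by rewrite /sym_act rmorphM. Qed.

Lemma sym_actC w c : sym_act w c%:MP = c%:MP.
Proof. by rewrite /sym_act comp_mpolyC. Qed.

Lemma sym_act_of w v : sym_act w (sym_of v) = sym_of (w v).
Proof.
rewrite [in RHS](coord_vbasis (memvf v)) linear_sum /=.
under eq_bigr do rewrite linearZ /=.
rewrite sym_of_sum /sym_of /sym_act linear_sum /=; apply: eq_bigr => i _.
by rewrite linearZ /= -/(sym_act w 'X_i) sym_actX.
Qed.

Lemma sym_act_comp u w p : sym_act u (sym_act w p) = sym_act (u \o w)%VF p.
Proof.
apply: (symalg_morph_eq (f := sym_act u \o sym_act w))
  => [c|v|x y|x y|x y|x y] /=.
- by rewrite !sym_actC.
- by rewrite !sym_act_of comp_lfunE.
- exact: etrans (congr1 _ (sym_actD w x y)) (sym_actD u _ _).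
- exact: sym_actD.
- exact: etrans (congr1 _ (sym_actM w x y)) (sym_actM u _ _).
- exact: sym_actM.
Qed.

Lemma sym_act1 p : sym_act \1%VF p = p.
Proof.
apply: (symalg_morph_eq (g := id)) => [c|v|x y|x y|x y|x y] //=.
- exact: sym_actC.
- by rewrite sym_act_of id_lfunE.
- exact: sym_actD.
- exact: sym_actM.
Qed.

Lemma sym_eval_of (nu : complexified V') v : sym_eval rs nu (sym_of v) =
  pairing rs v (re_part nu) +i* pairing rs v (im_part nu).
Proof.
rewrite /sym_eval /sym_of linear_sum /=.
under eq_bigr do rewrite mevalZ mevalXU.
pose F v := pairing rs v (re_part nu) +i* pairing rs v (im_part nu).
have FD x y : F (x + y) = F x + F y by rewrite /F !pairingDl.
have F0 : F 0 = 0 by rewrite /F !pairing0l.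
have FZ c x : F (c *: x) = c%:C * F x.
  rewrite /F !pairingZl; apply/eqP.
  by rewrite eq_complex /= !mul0r subr0 addr0 !eqxx.
rewrite -/(F v) [in RHS](coord_vbasis (memvf v)) (big_morph F FD F0).
by apply: eq_bigr => i _; rewrite FZ.
Qed.

End SymAct.

(** The character of S(V_C) at the point $u^{-1}\nu$.  It is locked because
    unification would otherwise evaluate polynomials. *)
HB.lock Definition weight (R : realType) (V V' : vectType R)
    (rs : root_system V V') (nu : complexified V') (u : 'End(V)) (p : symalg V) :=
  sym_eval rs nu (sym_act u p).

Section Weights.
Context (R : realType) (V V' : vectType R) (rs : root_system V V').
Implicit Types (u w : 'End(V)) (p q : symalg V).

Local Notation weight := (weight rs).

Section WeightTheory.
Context (nu : complexified V').

Lemma weightD u p q :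
  weight nu u (p + q) = weight nu u p + weight nu u q.
Proof. by rewrite weight.unlock sym_actD /sym_eval mevalD. Qed.

Lemma weightM u p q :
  weight nu u (p * q) = weight nu u p * weight nu u q.
Proof. by rewrite weight.unlock sym_actM /sym_eval mevalM. Qed.

Lemma weightC u c : weight nu u c%:MP = c.
Proof. by rewrite weight.unlock sym_actC /sym_eval mevalC. Qed.

Lemma weightB u p q :
  weight nu u (p - q) = weight nu u p - weight nu u q.
Proof.
rewrite weightD -mulN1r -mpolyC1 -rmorphN weightM weightC.
by rewrite mulN1r.
Qed.

Lemma weight_of u v : weight nu u (sym_of v) =
  pairing rs (u v) (re_part nu) +i* pairing rs (u v) (im_part nu).
Proof. by rewrite weight.unlock sym_act_of sym_eval_of. Qed.

Lemma weight_comp u w p : weight nu u (sym_act w p) = weight nu (u \o w)%VF p.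
Proof. by rewrite weight.unlock sym_act_comp. Qed.

Lemma weight1 p : weight nu \1%VF p = sym_eval rs nu p.
Proof. by rewrite weight.unlock sym_act1. Qed.

Lemma eq_weight u w :
  (forall v, weight nu u (sym_of v) = weight nu w (sym_of v)) ->
  weight nu u =1 weight nu w.
Proof.
move=> e; apply: symalg_morph_eq => [c|v|p q|p q|p q|p q].
- exact: etrans (weightC u c) (esym (weightC w c)).
- exact: e.
- exact: weightD.
- exact: weightD.
- exact: weightM.
- exact: weightM.
Qed.

End WeightTheory.

Lemma sym_of_root_neq0 a : a \in roots rs -> sym_of a != 0.
Proof.
move=> aR; apply/eqP=> a0.
have := sym_eval_of rs (Complexified (coroot rs a) 0) a.
rewrite a0 /sym_eval meval0 /= pairing_coroot // pairing0r.
by move=> /eqP; rewrite eq_complex /= eq_sym pnatr_eq0.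
Qed.

Lemma divdiff_of a v : a \in roots rs ->
  divdiff rs a (sym_of v) = (pairing rs v (coroot rs a))%:C%:MP.
Proof.
move=> aR; apply: (mulfI (sym_of_root_neq0 aR)); rewrite divdiffP sym_act_of.
rewrite reflectionE (addrC v) -scaleNr sym_of_linear rmorphN scaleNr.
by rewrite opprD opprK addrCA subrr addr0 mulrC mul_mpolyC.
Qed.

Lemma weight_divdiff nu u a p :
  weight nu u (sym_of a) * weight nu u (divdiff rs a p) =
  weight nu u p - weight nu (u \o reflection rs a)%VF p.
Proof. by rewrite -weightM divdiffP weightB weight_comp. Qed.

End Weights.

Section HeckeModules.
Context (R : realType) (V V' : vectType R) (rs : root_system V V').
Context (Pi : seq V) (Pi_simple : simple_roots rs Pi) (HH : graded_hecke rs Pi).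

Local Notation s := (reflection rs).
Local Notation t := (hecke_t HH).
Local Notation theta := (hecke_theta HH).

Lemma theta_const c : theta c%:MP = c%:A.
Proof. by rewrite -[c%:MP]mulr1 mul_mpolyC linearZ /= rmorph1. Qed.

Lemma hecke_cross_of a v : a \in Pi ->
  theta (sym_of v) * t (s a) =
  t (s a) * theta (sym_of (s a v)) + (pairing rs v (coroot rs a))%:C%:A.
Proof.
move=> aPi; rewrite hecke_cross // sym_act_of divdiff_of ?theta_const //.
exact: simple_root aPi.
Qed.

Lemma t_reflectionK a : a \in Pi -> t (s a) * t (s a) = 1.
Proof.
move=> aPi; have aR := simple_root Pi_simple aPi.
by rewrite -hecke_tM ?reflection_comp2 ?hecke_t1 //; apply: weyl_reflection.
Qed.

Lemma t_word ws : {subset ws <= Pi} ->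
  t (word_op rs (rev ws)) = \prod_(a <- ws) t (s a).
Proof.
elim: ws => [|a ws IH]; first by rewrite big_nil /= hecke_t1.
move=> /subset_cons[aPi sub]; rewrite big_cons rev_cons word_op_rcons.
have aR := simple_root Pi_simple aPi.
rewrite hecke_tM ?IH //; first exact: weyl_reflection.
by apply: weyl_word Pi_simple _ _ => b; rewrite mem_rev => /sub.
Qed.

(** The spanning family is indexed by all of $W$, but crossing relations are
    given only for simple reflections, which is why words are used. *)
Lemma hecke_word_ind (P : HH -> Prop) :
    P 0 -> (forall h k, P h -> P k -> P (h + k)) ->
    (forall ws p, {subset ws <= Pi} ->
       P ((\prod_(a <- ws) t (s a)) * theta p)) ->
  forall h, P h.
Proof.
move=> P0 PD PW h; have [ws [p [wsW ->]]] := hecke_span h.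
rewrite big_seq; elim/big_ind: _ => // w /wsW/(weyl_wordP Pi_simple)[us sub ->].
rewrite -[us]revK t_word; first by apply: PW => a; rewrite mem_rev => /sub.
by move=> a; rewrite mem_rev => /sub.
Qed.

Section Module.
Context (X : lmodType HH).
Implicit Types (x y : X) (c : R[i]) (h : HH).

Definition cscale (c : R[i]) (x : X) : X := (c%:A : HH) *: x.
Local Notation "c *:: x" := (cscale c x) (at level 40).

Lemma cscaleA c d x : c *:: (d *:: x) = (c * d) *:: x.
Proof. by rewrite /cscale scalerA -scalerAl mul1r scalerA. Qed.

Lemma cscale1 x : 1 *:: x = x.
Proof. by rewrite /cscale scale1r scale1r. Qed.

Lemma cscaleDl c d x : (c + d) *:: x = c *:: x + d *:: x.
Proof. by rewrite /cscale scalerDl scalerDl. Qed.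

Lemma cscaleDr c x y : c *:: (x + y) = c *:: x + c *:: y.
Proof. by rewrite /cscale scalerDr. Qed.

Lemma cscaleNr c x : c *:: (- x) = - (c *:: x).
Proof. by rewrite /cscale scalerN. Qed.

Lemma cscaleNl c x : (- c) *:: x = - (c *:: x).
Proof. by rewrite /cscale scaleNr scaleNr. Qed.

Lemma cscale0l x : 0 *:: x = 0.
Proof. by rewrite /cscale scale0r scale0r. Qed.

Lemma cscale0r c : c *:: 0 = 0.
Proof. by rewrite /cscale scaler0. Qed.

Lemma cscale_comm h c x : h *: (c *:: x) = c *:: (h *: x).
Proof. by rewrite /cscale !scalerA -scalerAl -scalerAr mul1r mulr1. Qed.

Lemma scaler_cscale c h x : (c *: h) *: x = c *:: (h *: x).
Proof. by rewrite /cscale scalerA -scalerAl mul1r. Qed.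

Lemma cscale_inj0 c x : c != 0 -> c *:: x = 0 -> x = 0.
Proof.
move=> c0 /(congr1 (cscale c^-1)).
by rewrite cscaleA mulVf // cscale1 cscale0r.
Qed.

Lemma theta_const_scale c x : theta c%:MP *: x = c *:: x.
Proof. by rewrite theta_const. Qed.

Lemma theta_scaleM p q x : theta (p * q) *: x = theta p *: (theta q *: x).
Proof. by rewrite scalerA rmorphM. Qed.

Lemma theta_scaleC p q x :
  theta p *: (theta q *: x) = theta q *: (theta p *: x).
Proof. by rewrite -!theta_scaleM mulrC. Qed.

Lemma hecke_module_ind (P : X -> Prop) x :
    P 0 -> (forall y z, P y -> P z -> P (y + z)) ->
    (forall p y, P y -> P (theta p *: y)) ->
    (forall a y, a \in Pi -> P y -> P (t (s a) *: y)) ->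
  P x -> forall h, P (h *: x).
Proof.
move=> P0 PD Ptheta Pt Px; elim/hecke_word_ind => [|h k Ph Pk|ws p sub].
- by rewrite scale0r.
- by rewrite scalerDl; apply: PD.
- rewrite -scalerA; have : P (theta p *: x) by apply: Ptheta.
  move: (theta p *: x) => y Py; elim: ws sub => [|a ws IH] sub.
    by rewrite big_nil scale1r.
  move: sub => /subset_cons[aPi sub]; rewrite big_cons -scalerA.
  by apply: Pt => //; apply: IH.
Qed.

Lemma cross_scale a p x : a \in Pi ->
  theta p *: (t (s a) *: x) =
  t (s a) *: (theta (sym_act (s a) p) *: x) + theta (divdiff rs a p) *: x.
Proof. by move=> aPi; rewrite !scalerA -scalerDl hecke_cross. Qed.

Section Weight.
Context (nu : complexified V').

Definition weight_vector (u : 'End(V)) x :=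
  forall p, theta p *: x = weight rs nu u p *:: x.

Lemma weight_vector0 u : weight_vector u 0.
Proof. by move=> p; rewrite scaler0 cscale0r. Qed.

Lemma weight_vectorD u x y :
  weight_vector u x -> weight_vector u y -> weight_vector u (x + y).
Proof. by move=> wx wy p; rewrite scalerDr wx wy cscaleDr. Qed.

Lemma weight_vectorZ u c x : weight_vector u x -> weight_vector u (c *:: x).
Proof. by move=> wx p; rewrite cscale_comm wx !cscaleA mulrC. Qed.

Lemma eq_weight_vector u w x : weight rs nu u =1 weight rs nu w ->
  weight_vector u x -> weight_vector w x.
Proof. by move=> e wx p; rewrite wx e. Qed.

(** The intertwiner $t_\alpha-(\alpha,\lambda)^{-1}$ carries the weight
    $\lambda$ to $s_\alpha\lambda$. *)
Definition intertwine (u : 'End(V)) a x :=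
  t (s a) *: x - (weight rs nu u (sym_of a))^-1 *:: x.

Lemma intertwine_weight u a x : a \in Pi -> weight rs nu u (sym_of a) != 0 ->
  weight_vector u x -> weight_vector (u \o s a)%VF (intertwine u a x).
Proof.
move=> aPi n0 wx p; rewrite /intertwine scalerBr cross_scale // wx weight_comp.
rewrite cscale_comm !wx cscale_comm cscaleDr cscaleNr !cscaleA -addrA.
congr (_ + _).
set n := weight rs nu u (sym_of a) in n0 *.
have -> : weight rs nu u (divdiff rs a p) =
    n^-1 * (weight rs nu u p - weight rs nu (u \o s a)%VF p).
  by rewrite -weight_divdiff mulKf.
rewrite wx cscaleA -!cscaleNl -cscaleDl; congr cscale.
by rewrite mulrBr addrAC subrr add0r mulrC.
Qed.

End Weight.
End Module.
End HeckeModules.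

(** * Weight vectors in the spherical module *)

Section WeightVectors.
Context (R : realType) (V V' : vectType R) (rs : root_system V V').
Context (Pi : seq V) (Pi_simple : simple_roots rs Pi) (HH : graded_hecke rs Pi).
Context (nu : complexified V').

Local Notation s := (reflection rs).
Local Notation t := (hecke_t HH).
Local Notation theta := (hecke_theta HH).
Local Notation "c *:: x" := (cscale c x) (at level 40).
Local Notation weight := (weight rs nu).

(** Generators of the product of the maximal ideals at the listed weights. *)
Fixpoint weight_product (us : seq 'End(V)) (p : symalg V) : Prop :=
  if us is u :: us' then
    exists q r, [/\ p = q * r, weight u q = 0 & weight_product us' r]
  else True.

Lemma weight_product_cat us1 us2 p : weight_product (us1 ++ us2) p ->
  exists q r, [/\ p = q * r, weight_product us1 q & weight_product us2 r].
Proof.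
elim: us1 p => [|u us1 IH] p; first by exists 1, p; rewrite mul1r.
move=> [q [r [-> q0 /IH[q' [r' [-> q'P r'P]]]]]].
exists (q * q'), r'; split=> //; first by rewrite mulrA.
by exists q, q'.
Qed.

Lemma weight_product_act a us p :
  weight_product [seq (u \o s a)%VF | u <- us] p ->
  weight_product us (sym_act (s a) p).
Proof.
elim: us p => [//|u us IH] p [q [r [-> q0 /IH rP]]].
exists (sym_act (s a) q), (sym_act (s a) r); split=> //; first exact: sym_actM.
by rewrite weight_comp.
Qed.

(** The vectors on which the commutative subalgebra acts with finitely many
    generalized weights, all in the orbit of $\nu$. *)
Definition weight_finite (X : lmodType HH) (x : X) :=
  exists us : seq 'End(V), (forall u, u \in us -> weyl_group rs u) /\
    forall p, weight_product us p -> theta p *: x = 0.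

(** For a reflection the crossing relation gives
    $P t_\alpha x = t_\alpha (s_\alpha P)x + \Delta_\alpha(P) x$: a product P for
    the reflected weights kills the first term, and a further product for the
    original ones kills the second. *)
Lemma weight_finite_module (X : lmodType HH) (x : X) h :
  weight_finite x -> weight_finite (h *: x).
Proof.
move=> xf; apply: (hecke_module_ind Pi_simple (P := @weight_finite X)) xf h.
- by exists [::]; split=> // p _; rewrite scaler0.
- move=> y z [us [usW usP]] [vs [vsW vsP]]; exists (us ++ vs); split=> [u|p].
    by rewrite mem_cat => /orP[/usW|/vsW].
  move=> /weight_product_cat[q [r [-> qP rP]]]; rewrite scalerDr.
  rewrite [X in X + _]theta_scaleM theta_scaleC usP // scaler0 add0r.
  by rewrite theta_scaleM vsP // scaler0.
- move=> q y [us [usW usP]]; exists us; split=> // p pP.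
  by rewrite theta_scaleC usP // scaler0.
- move=> a y aPi [us [usW usP]]; have aR := simple_root Pi_simple aPi.
  exists ([seq (u \o s a)%VF | u <- us] ++ us); split=> [u|p].
    rewrite mem_cat => /orP[/mapP[w /usW wW ->]|/usW //].
    by apply: weyl_groupC => //; apply: weyl_reflection.
  move=> /weight_product_cat[q [r [-> qP rP]]].
  rewrite theta_scaleM theta_scaleC cross_scale //.
  rewrite (usP _ (weight_product_act qP)) scaler0 add0r.
  by rewrite theta_scaleC (usP _ rP) scaler0.
Qed.

Lemma principal_series_finite (x : principal_series HH nu) : weight_finite x.
Proof.
have [h ->] := ps_class_surj x.
have -> : ps_class nu h = h *: ps_class nu (1 : HH).
  by rewrite [RHS]ps_scaleE mulr1.
apply: weight_finite_module; exists [:: \1%VF]; split=> [u|p].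
  by rewrite inE => /eqP->; constructor.
move=> [q [r [-> q0 _]]]; rewrite theta_scaleM theta_scaleC.
suff -> : theta q *: ps_class nu (1 : HH) = 0 by rewrite scaler0.
rewrite [LHS]ps_scaleE mulr1 -[RHS](subrr (ps_class nu 0)) -ps_classB subrr.
apply/ps_classP; apply/asboolP; exists [:: (1, q)].
by rewrite big_seq1 /= -weight1 q0 scale0r !subr0 mul1r.
Qed.

Lemma subquotient_finite (X : lmodType HH) (x : X) :
  subquotient (principal_series HH nu) X -> weight_finite x.
Proof.
move=> [M [f [[M0 Mlin] flin fsurj]]]; have [y yM <-] := fsurj x.
have f0 : f 0 = 0.
  have := flin 0 0 M0 M0 1; rewrite !scale1r addr0 => /eqP.
  by rewrite -subr_eq subrr eq_sym => /eqP.
have fZ h : f (h *: y) = h *: f y.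
  by have := flin y 0 yM M0 h; rewrite !addr0 f0 addr0.
have [us [usW usP]] := principal_series_finite y; exists us; split=> // p pP.
by rewrite -fZ usP.
Qed.

(** If x is not killed by some polynomial vanishing at the first weight, replace
    it by that multiple and go on; this must stop at a weight vector. *)
Lemma weight_vector_exists (X : lmodType HH) (x : X) : x != 0 ->
  weight_finite x ->
  exists u y, [/\ weyl_group rs u, y != 0 & weight_vector nu u (y : X)].
Proof.
move=> x0 [us [usW usP]]; elim: us x x0 usW usP => [|u us IH] x x0 usW usP.
  by move: x0; rewrite -[x]scale1r -(rmorph1 theta) usP // eqxx.
have [[q q0 qx]|nex] := pselect (exists2 q, weight u q = 0 & theta q *: x != 0).
  apply: (IH _ qx) => [w wus|r rP]; first by apply: usW; rewrite inE wus orbT.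
  by rewrite theta_scaleC -theta_scaleM; apply: usP; exists q, r.
exists u, x; split=> // [|p]; first by apply: usW; rewrite inE eqxx.
apply/eqP; rewrite -subr_eq0 -[_ *:: x]theta_const_scale -scalerBl -rmorphB.
apply/negPn/negP=> px; apply: nex; exists (p - (weight u p)%:MP) => //.
by rewrite weightB weightC subrr.
Qed.

Section Irreducible.
Context (X : lmodType HH) (X_irr : irreducible X).

Lemma irreducible_gen (x : X) : x != 0 -> forall y, exists h, y = h *: x.
Proof.
move=> x0 y; case: X_irr => _ /(_ (fun z => `[< exists h, z = h *: x >])) [].
- split=> [|a _ _ /asboolP[h ->] /asboolP[k ->]]; apply/asboolP.
    by exists 0; rewrite scale0r.
  by exists (a * h + k); rewrite scalerDl scalerA.
- move=> /(_ x) x0'; move: x0; rewrite x0' ?eqxx //; apply/asboolP.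
  by exists 1; rewrite scale1r.
- by move=> /(_ y)/asboolP.
Qed.

(** The symmetrizer over $W$ would kill the line of such a y, hence all of
    $\mathbb H y = X$, but it multiplies the spherical vector by |W|. *)
Lemma spherical_no_sign (y : X) u a : spherical X -> a \in Pi -> y != 0 ->
  weight_vector nu u y -> t (s a) *: y <> - y.
Proof.
move=> [f [_ fW [z0 fz0]]] aPi y0 wy ty.
have aR := simple_root Pi_simple aPi.
have [Ws [Wuniq WsP]] := weyl_finite Pi_simple.
pose S (x : X) : X := \sum_(w <- Ws) t w *: x.
have SD x z : S (x + z) = S x + S z.
  by rewrite /S -big_split; apply: eq_bigr => w _; rewrite scalerDr.
have S0 : S 0 = 0 by rewrite /S big1 // => w _; rewrite scaler0.
have SZ c x : S (c *:: x) = c *:: S x.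
  rewrite /S; elim: Ws {Wuniq WsP S SD S0} => [|w Ws IH].
    by rewrite !big_nil cscale0r.
  by rewrite !big_cons IH cscale_comm cscaleDr.
have St v x : weyl_group rs v -> S (t v *: x) = S x.
  move=> vW; have [v' v'W [e1 e2]] := weyl_inv vW.
  have pW : perm_eq [seq (w \o v)%VF | w <- Ws] Ws.
    apply: uniq_perm => // [|w].
      rewrite map_inj_uniq // => w1 w2 /(congr1 (fun g => (g \o v')%VF)).
      by rewrite -!comp_lfunA e1 !comp_lfun1r.
    apply/mapP/idP => [[w1 /WsP w1W ->]|/WsP wW].
      by apply/WsP; apply: weyl_groupC.
    exists (w \o v')%VF; first by apply/WsP; apply: weyl_groupC.
    by rewrite -comp_lfunA e2 comp_lfun1r.
  rewrite /S -[RHS](perm_big _ pW) big_map /= big_seq [RHS]big_seq.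
  by apply: eq_bigr => w /WsP wW; rewrite scalerA -hecke_tM.
have two0 (x : X) : x = - x -> x = 0.
  move=> e; apply: (@cscale_inj0 _ _ _ _ _ _ _ 2); first by rewrite pnatr_eq0.
  by rewrite -[2]/(1 + 1) cscaleDl cscale1 {1}e addNr.
have Sy : S y = 0.
  apply: two0; have := St _ y (weyl_reflection aR); rewrite ty => {1}<-.
  by rewrite -[- y]cscale1 cscaleNr -cscaleNl SZ cscaleNl cscale1.
have Sh h : S (h *: y) = 0.
  have [ws [p [wsW ->]]] := hecke_span h; rewrite scaler_suml big_seq.
  elim/big_ind: _ => // [x z Sx Sz|w /wsW wW]; first by rewrite SD Sx Sz addr0.
  by rewrite -scalerA wy cscale_comm SZ St // Sy cscale0r.
have [h fzE] := irreducible_gen y0 (f z0).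
move: fz0; apply/negP/negPn/eqP; have := Sh h; rewrite -fzE.
have -> : S (f z0) = (size Ws)%:R *:: f z0.
  have : forall w, w \in Ws -> weyl_group rs w by move=> w /WsP.
  rewrite /S; elim: Ws {Wuniq WsP S SD S0 SZ St Sy Sh} => [|w Ws IH] sub.
    by rewrite big_nil cscale0l.
  rewrite big_cons fW ?IH; last by apply: sub; rewrite inE eqxx.
    by rewrite /= -natr1 addrC cscaleDl cscale1.
  by move=> w' w'W; apply: sub; rewrite inE w'W orbT.
apply: cscale_inj0; rewrite pnatr_eq0 -lt0n.
have : \1%VF \in Ws by apply/WsP; constructor.
by case: (Ws).
Qed.

Context (X_sph : spherical X) (nu_real : im_part nu = 0).
Local Notation l := (re_part nu).

Lemma weight_real u v : weight u (sym_of v) = (pairing rs (u v) l)%:C.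
Proof. by rewrite weight_of nu_real pairing0r. Qed.

(** Otherwise $t_\alpha y=y/n$ with $t_\alpha^2=1$ and $n<0$, so that
    $t_\alpha y=-y$, which is impossible in the spherical module. *)
Lemma intertwine_neq0 u a (y : X) : a \in Pi -> y != 0 ->
  weight_vector nu u y -> pairing rs (u a) l < 0 -> intertwine nu u a y != 0.
Proof.
move=> aPi y0 wy neg; rewrite /intertwine weight_real.
set n := pairing rs (u a) l in neg *.
apply/eqP => /eqP; rewrite subr_eq0 => /eqP ty.
have n2 : (n%:C^-1 * n%:C^-1 - 1) *:: y = 0.
  rewrite cscaleDl cscaleNl cscale1 -cscaleA -{1}ty -cscale_comm -ty.
  by rewrite scalerA t_reflectionK // scale1r subrr.
have : (n%:C^-1 * n%:C^-1 - 1) == 0.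
  by apply: contraNT y0 => /cscale_inj0/(_ n2)->.
rewrite subr_eq0 -expr2 sqrf_eq1 => /orP[/eqP e|/eqP e].
  have : 0 < n%:C by rewrite -invr_gt0 e ltr01.
  by rewrite ltcR; lra.
apply: (spherical_no_sign X_sph aPi y0 wy).
by rewrite ty e cscaleNl cscale1.
Qed.

Context (nu_dom : dominant rs Pi nu).

(** Either the weight is dominant, hence equal to $\nu$, or an intertwiner
    moves it along a shorter element of $W$. *)
Lemma weight_ind (P : X -> Prop) :
    (forall y, y != 0 -> weight_vector nu \1%VF y -> P y) ->
    (forall u a y, weyl_group rs u -> a \in Pi -> y != 0 ->
       weight_vector nu u y -> pairing rs (u a) l < 0 ->
       P (intertwine nu u a y) -> P y) ->
  forall u y, weyl_group rs u -> y != 0 -> weight_vector nu u y -> P y.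
Proof.
move=> P1 PS u y /(weyl_wordP Pi_simple)[ws sub ->].
have [n] := ubnP (size ws).
elim: n ws y sub => // n IH ws y sub; rewrite ltnS => szn y0 wy.
have [[a aPi neg]|nex] :=
  pselect (exists2 a, a \in Pi & pairing rs (word_op rs ws a) l < 0).
  have wW := weyl_word Pi_simple sub.
  have aR := simple_root Pi_simple aPi.
  have negR : positive rs Pi (- word_op rs ws a).
    have [/(positive_pairing_ge0 nu_dom)|//] :=
      root_sign Pi_simple (weyl_roots wW aR).
    by move: neg; lra.
  have [ws' [sub' sz e]] := exchange Pi_simple sub aPi negR.
  apply: (PS (word_op rs ws) a) => //; apply: (IH ws') => //.
  - by rewrite -sz.
  - exact: intertwine_neq0.
  - rewrite -e; apply: intertwine_weight => //; rewrite weight_real.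
    by rewrite fmorph_eq0 lt_eqF.
apply: P1 => //; apply: eq_weight_vector wy; apply: eq_weight => v.
rewrite !weight_real id_lfunE; congr _%:C.
apply: (dominant_unique Pi_simple sub) => // a aPi.
by rewrite leNgt; apply/negP=> neg; apply: nex; exists a.
Qed.

Lemma dominant_weight_vector : (forall x : X, weight_finite x) ->
  exists2 x : X, x != 0 & weight_vector nu \1%VF x.
Proof.
move=> Xf; case: (X_irr) => [[x x0] _].
have [u [y [uW y0 wy]]] := weight_vector_exists x0 (Xf x).
apply: (weight_ind (P := fun=> exists2 z : X, z != 0 & weight_vector nu \1%VF z))
  uW y0 wy => // z z0 wz.
by exists z.
Qed.

End Irreducible.
End WeightVectors.

(** * The closed chamber and the necessity of the inequalities *)

Section Chamber.
Context (R : realType) (V V' : vectType R) (rs : root_system V V') (Pi : seq V).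

Lemma vclosureP (U : vectType R) (A : set U) x : vclosure A x <->
  forall e : R, 0 < e -> exists2 y, A y &
    forall i, `|coord (vbasis {: U}) i x - coord (vbasis {: U}) i y| < e.
Proof.
rewrite /vclosure /closure /=; split=> [cl e e0|cl B].
  have [] := cl (ball (passmx.rVof (vbasis {: U}) x) e).
    exact: nbhsx_ballx.
  move=> _ [[y Ay <-] [_ xy]]; exists y => // i.
  by have := xy ord0 i; rewrite !mxE.
move=> /nbhs_ballP[e /= e0 eB]; have [y Ay xy] := cl e e0.
exists (passmx.rVof (vbasis {: U}) y); split; first by exists y.
apply: eB; split=> // i j; rewrite !mxE; exact: xy.
Qed.

(** The closed cone is the closure of the open one because dilating a point by
    $1+\delta$ makes the inequalities strict. *)
Lemma closure_C_infty l : vclosure (C_infty rs Pi) l <->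
  forall a, a \in Pi -> 1 <= pairing rs a l.
Proof.
rewrite vclosureP; set b := vbasis {: V'}; split=> [cl a aPi|dom e e0].
  rewrite leNgt; apply/negP=> lt1.
  pose K := \sum_(i < \dim {: V'}) `|pairing rs a b`_i|.
  have K0 : 0 <= K by apply: sumr_ge0.
  pose e := (1 - pairing rs a l) / (K + 1).
  have e0 : 0 < e by rewrite divr_gt0 //; lra.
  have [m mC lm] := cl e e0; have := mC a aPi.
  suff : pairing rs a m - pairing rs a l <= e * K.
    have : e * (K + 1) = 1 - pairing rs a l by rewrite divfK //; lra.
    by have := mulr_ge0 (ltW e0) K0; lra.
  have -> : pairing rs a m - pairing rs a l =
      \sum_(i < \dim {: V'}) coord b i (m - l) * pairing rs a b`_i.
    rewrite -pairingBr {1}(coord_vbasis (memvf (m - l))).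
    rewrite (big_morph (pairing rs a) (pairingDr rs a) (pairing0r rs a)).
    by apply: eq_bigr => i _; rewrite pairingZr.
  rewrite mulr_sumr; apply: ler_sum => i _.
  apply: le_trans (ler_norm _) _; rewrite normrM ler_wpM2r //.
  by rewrite linearB distrC ltW ?lm.
pose K := \sum_(i < \dim {: V'}) `|coord b i l|.
have K0 : 0 <= K by apply: sumr_ge0.
pose d := e / (K + 1).
have d0 : 0 < d by rewrite divr_gt0 //; lra.
exists ((1 + d) *: l) => [a aPi|i]; rewrite /=.
  rewrite pairingZr; have := dom a aPi => h.
  by have := mulr_ge0 (ltW d0) (le_trans ler01 h); nra.
rewrite linearZ /= -{1}[coord b i l]mul1r -mulrBl opprD addNKr.
rewrite normrM normrN (gtr0_norm d0).
have -> : e = d * (K + 1) by rewrite divfK //; lra.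
rewrite ltr_pM2l // /K (bigD1 i) //=.
have : 0 <= \sum_(j | j != i) `|coord b j l| by apply: sumr_ge0.
by lra.
Qed.

End Chamber.

Section UnitaryNecessary.
Context (R : realType) (V V' : vectType R) (rs : root_system V V').
Context (Pi : seq V) (Pi_simple : simple_roots rs Pi) (HH : graded_hecke rs Pi).
Context (bullet : HH -> HH) (bulletP : is_bullet bullet).
Context (nu : complexified V').

Local Notation s := (reflection rs).
Local Notation t := (hecke_t HH).
Local Notation theta := (hecke_theta HH).
Local Notation "c *:: x" := (cscale c x) (at level 40).
Local Notation weight := (weight rs nu).

Lemma bullet_of v : bullet (theta (sym_of v)) = theta (sym_of v).
Proof.
have := bullet_theta bulletP (Complexified v 0).
by rewrite /cconj /sym_ofC /= oppr0 sym_of0 scaler0 addr0.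
Qed.

Lemma bullet_reflection a : a \in Pi -> bullet (t (s a)) = t (s a).
Proof.
move=> aPi; have aR := simple_root Pi_simple aPi.
rewrite (bullet_t bulletP (weyl_reflection aR)).
by rewrite (reflection_inv aR).
Qed.

Section Form.
Context (X : lmodType HH) (form : X -> X -> R[i]).
Context (form_linl : forall (c : R[i]) x y z,
  form ((c%:A : HH) *: x + y) z = c * form x z + form y z).
Context (form_conj : forall x y, form y x = Num.conj (form x y)).
Context (form_adj : forall (h : HH) x y,
  form (h *: x) y = form x (bullet h *: y)).

Lemma formDl x y z : form (x + y) z = form x z + form y z.
Proof. by have := form_linl 1 x y z; rewrite scale1r scale1r mul1r. Qed.

Lemma form0l z : form 0 z = 0.
Proof. by apply: (addrI (form 0 z)); rewrite -formDl !addr0. Qed.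

Lemma formZl c x z : form (c *:: x) z = c * form x z.
Proof. by have := form_linl c x 0 z; rewrite !addr0 form0l addr0. Qed.

Lemma formDr x y z : form x (y + z) = form x y + form x z.
Proof. by rewrite form_conj formDl rmorphD /= -!form_conj. Qed.

Lemma form0r x : form x 0 = 0.
Proof. by rewrite form_conj form0l rmorph0. Qed.

Lemma formZr c x z : form x (c *:: z) = Num.conj c * form x z.
Proof. by rewrite form_conj formZl rmorphM /= -form_conj. Qed.

Lemma formNl x z : form (- x) z = - form x z.
Proof. by rewrite -[- x](cscale1) cscaleNr -cscaleNl formZl mulN1r. Qed.

Lemma formNr x z : form x (- z) = - form x z.
Proof. by rewrite form_conj formNl rmorphN /= -form_conj. Qed.

Lemma form_theta v x y :
  form (theta (sym_of v) *: x) y = form x (theta (sym_of v) *: y).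
Proof. by rewrite form_adj bullet_of. Qed.

Lemma form_t a x y : a \in Pi -> form (t (s a) *: x) y = form x (t (s a) *: y).
Proof. by move=> aPi; rewrite form_adj bullet_reflection. Qed.

Lemma form_t2 a x y : a \in Pi -> form (t (s a) *: x) (t (s a) *: y) = form x y.
Proof.
by move=> aPi; rewrite form_t // scalerA (t_reflectionK Pi_simple) // scale1r.
Qed.

Lemma form_weight_orth u w x y v :
  weight_vector nu u x -> weight_vector nu w y ->
  weight u (sym_of v) != Num.conj (weight w (sym_of v)) -> form x y = 0.
Proof.
move=> wx wy; have := form_theta v x y; rewrite wx wy formZl formZr => /eqP.
by rewrite -subr_eq0 -mulrBl mulf_eq0 subr_eq0 => /orP[->|/eqP].
Qed.

Context (nu_real : im_part nu = 0).
Local Notation l := (re_part nu).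

Lemma conj_real (c : R) : Num.conj (c%:C) = c%:C.
Proof.
by apply: conj_Creal; rewrite realE -(rmorph0 (real_complex R)) !lecR le_total.
Qed.

(** An intertwined vector is orthogonal to the original one, their weights
    having opposite values on $\alpha$; this determines $(t_\alpha x,x)$. *)
Lemma form_t_weight (u : 'End(V)) a x : a \in Pi -> pairing rs (u a) l != 0 ->
  weight_vector nu u x ->
  form (t (s a) *: x) x = (pairing rs (u a) l)%:C^-1 * form x x.
Proof.
move=> aPi n0 wx; have aR := simple_root Pi_simple aPi.
have nE : weight u (sym_of a) = (pairing rs (u a) l)%:C by apply: weight_real.
have nC : weight u (sym_of a) != 0 by rewrite nE fmorph_eq0.
have := form_weight_orth (v := a) (intertwine_weight aPi nC wx) wx.
rewrite nE conj_real (weight_real _ nu_real) comp_lfunE reflection_root //.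
rewrite linearN pairingNl /intertwine formDl formNl formZl nE.
move=> /(_ _)/eqP; rewrite subr_eq0 => h; apply/eqP/h.
by rewrite (inj_eq (fmorph_inj (real_complex R))); apply: contra_neq n0; lra.
Qed.

Lemma form_intertwine (u : 'End(V)) a x : a \in Pi -> pairing rs (u a) l != 0 ->
  weight_vector nu u x ->
  form (intertwine nu u a x) (intertwine nu u a x) =
  (1 - (pairing rs (u a) l) ^- 2)%:C * form x x.
Proof.
move=> aPi n0 wx; have e := form_t_weight aPi n0 wx.
rewrite /intertwine (weight_real _ nu_real).
rewrite formDl !formDr !formNl !formNr !formZl !formZr form_t2 //.
rewrite -(form_t _ _ aPi) e -fmorphV conj_real.
by rewrite -exprVn rmorphB rmorph1 rmorphXn /=; ring.
Qed.

End Form.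

Section Necessary.
Context (X : lmodType HH) (X_irr : irreducible X).
Context (X_fin : forall x : X, weight_finite nu x).

(** Elements of V are self-adjoint, so their eigenvalues $(uv,\nu)$ on a weight
    vector are real, and u is invertible. *)
Lemma unitary_real : unitary bullet X -> im_part nu = 0.
Proof.
move=> [form [flin fconj fpos fadj]]; case: (X_irr) => [[x x0] _].
have [u [y [uW y0 wy]]] := weight_vector_exists x0 (X_fin x).
apply: (pairing_nondegr (r := rs)) => v.
have [u' u'W [e1 e2]] := weyl_inv uW.
have := form_theta fadj (u' v) y y.
rewrite wy (formZl flin) (formZr flin fconj) weight_of -comp_lfunE e1 id_lfunE.
have y1 : form y y != 0 by rewrite gt_eqF ?fpos.
by move=> /(mulIf y1)/eqP; rewrite eq_complex /= eqxx /= => /eqP; lra.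
Qed.

(** For $n=(\alpha,\nu)>0$ the vector $t_\alpha x-x$ has squared norm
    $2(1-1/n)|x|^2$.  For $n=0$, $\alpha t_\alpha x=2x$ and $\alpha x=0$, so
    $2|x|^2=(t_\alpha x,\alpha x)=0$. *)
Lemma unitary_ge1 : spherical X -> dominant rs Pi nu -> unitary bullet X ->
  forall a, a \in Pi -> 1 <= pairing rs a (re_part nu).
Proof.
move=> X_sph dom U a aPi; have nu_real := unitary_real U.
have [x x0 wx] :=
  dominant_weight_vector Pi_simple X_irr X_sph nu_real dom X_fin.
move: U => [form [flin fconj fpos fadj]]; have aR := simple_root Pi_simple aPi.
have xx := fpos x x0; set n := pairing rs a (re_part nu).
have n0 : 0 <= n := dom a aPi.
have nE : weight \1%VF (sym_of a) = n%:C.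
  by rewrite (weight_real _ nu_real) id_lfunE.
have [nz|nz] := eqVneq n 0.
  have ax : theta (sym_of a) *: x = 0 by rewrite wx nE nz cscale0l.
  have tx : theta (sym_of a) *: (t (s a) *: x) = 2 *:: x.
    rewrite cross_scale // sym_act_of reflection_root // divdiff_of //.
    rewrite theta_const_scale pairing_coroot // sym_ofN rmorphN scaleNr ax.
    by rewrite oppr0 scaler0 add0r rmorph_nat.
  have := form_theta fadj a (t (s a) *: x) x.
  rewrite tx ax (formZl flin) (form0r flin fconj) => /eqP.
  by rewrite mulf_eq0 pnatr_eq0 /= gt_eqF.
have n0' : pairing rs ((\1%VF : 'End(V)) a) (re_part nu) != 0.
  by rewrite id_lfunE.
have e := form_t_weight flin fconj fadj nu_real aPi n0' wx.
rewrite id_lfunE in e.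
have : 0 <= form (t (s a) *: x - x) (t (s a) *: x - x).
  have [->|/fpos/ltW //] := eqVneq (t (s a) *: x - x) 0.
  by rewrite (form0l flin).
rewrite (formDl flin) !(formDr flin fconj) !(formNl flin) !(formNr flin fconj).
rewrite (form_t2 fadj) // -[form x (t _ *: x)](form_t fadj) // e opprK.
have -> : form x x - n%:C^-1 * form x x + (- (n%:C^-1 * form x x) + form x x) =
    (2 * (1 - n^-1))%:C * form x x.
  by rewrite rmorphM rmorphB rmorph1 rmorph_nat fmorphV /=; ring.
rewrite pmulr_lge0 // -[0]/(0%:C) lecR => h.
rewrite -invf_le1; last by rewrite lt_neqAle eq_sym nz.
lra.
Qed.

End Necessary.
End UnitaryNecessary.

(** * Construction of the invariant form *)

Section UnitarySufficient.
Context (R : realType) (V V' : vectType R) (rs : root_system V V').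
Context (Pi : seq V) (Pi_simple : simple_roots rs Pi) (HH : graded_hecke rs Pi).
Context (bullet : HH -> HH) (bulletP : is_bullet bullet).
Context (nu : complexified V') (nu_real : im_part nu = 0).

Local Notation s := (reflection rs).
Local Notation t := (hecke_t HH).
Local Notation theta := (hecke_theta HH).
Local Notation "c *:: x" := (cscale c x) (at level 40).
Local Notation weight := (weight rs nu).
Local Notation l := (re_part nu).
Local Notation T ws := (\prod_(a <- ws) t (s a)).

(** For a linear form the extra term of the crossing relation is a constant, so
    moving one across a product only adds scalar multiples of shorter products. *)
Lemma theta_word v ws : {subset ws <= Pi} -> exists r : seq (R[i] * seq V),
  (forall c, c \in r -> {subset c.2 <= Pi} /\ (size c.2 < size ws)%N) /\
  theta (sym_of v) * T ws =
    T ws * theta (sym_of (word_op rs ws v)) + \sum_(c <- r) c.1 *: T c.2.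
Proof.
elim: ws v => [|a ws IH] v.
  by exists [::]; split=> //; rewrite !big_nil mulr1 mul1r addr0 id_lfunE.
move=> /subset_cons[aPi sub]; have [r [rP e]] := IH (s a v) sub.
exists (((pairing rs v (coroot rs a))%:C, ws) ::
        [seq (c.1, a :: c.2) | c <- r]).
split=> [c|].
  rewrite inE => /orP[/eqP->|/mapP[d dr ->]] /=; first by split.
  by have [dsub dsz] := rP d dr; split=> //; apply/subset_cons.
rewrite big_cons mulrA (hecke_cross_of Pi_simple) // mulrDl -mulrA e.
rewrite mulrDr mulrA.
rewrite big_cons big_map /= -addrA comp_lfunE; congr (_ + _).
rewrite addrC mulr_sumr; congr (_ + _); first by rewrite mulr_algl.
by apply: eq_bigr => c _; rewrite big_cons scalerAr.
Qed.

Context (nu_ge1 : forall a, a \in Pi -> 1 <= pairing rs a l).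

Lemma root_ge1 b : positive rs Pi b -> 1 <= pairing rs b l.
Proof. exact: (positive_pairing_ge1 Pi_simple nu_ge1). Qed.

(** $\mathbb H$ is spanned by 1 modulo the left and right multiples of the
    $v-(v,\nu)$: for a word of product w, comparing $v t_w$ with
    $t_w\,w^{-1}v$ determines $t_w$ up to shorter words, unless $w\nu=\nu$,
    that is, w = 1 by regularity of $\nu$. *)
Lemma hecke_bimodule_ind (J : HH -> Prop) :
    J 0 -> (forall h k, J h -> J k -> J (h + k)) ->
    (forall c h, J h -> J (c *: h)) -> J 1 ->
    (forall v h, J ((theta (sym_of v) - (pairing rs v l)%:C%:A) * h)) ->
    (forall v h, J (h * (theta (sym_of v) - (pairing rs v l)%:C%:A))) ->
  forall h, J h.
Proof.
move=> J0 JD JZ J1 Jl Jr.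
have JN h : J h -> J (- h) by rewrite -scaleN1r; apply: JZ.
have Jp p : forall h, J (h * (theta p - (weight \1%VF p)%:A)).
  elim/symalg_ind: p => [c h|v h|p q IHp IHq h|p q IHp IHq h].
  - by rewrite weightC theta_const subrr mulr0.
  - by rewrite weight_real // id_lfunE.
  - rewrite weightD rmorphD scalerDl opprD addrACA mulrDr; exact: JD.
  - rewrite weightM rmorphM /=; set P := weight _ p; set Q := weight _ q.
    have -> : h * (theta p * theta q - (P * Q)%:A) =
        h * theta p * (theta q - Q%:A) + Q *: (h * (theta p - P%:A)).
      rewrite !mulrBr mulrA !mulr_algr scalerBr scalerA addrA subrK.
      by rewrite (mulrC Q).
    by apply: (JD); [exact: IHq|apply: (JZ)].
have Jsum (I : eqType) (r : seq I) (F : I -> HH) :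
    (forall i, i \in r -> J (F i)) -> J (\sum_(i <- r) F i).
  elim: r => [|i r IH] rP; first by rewrite big_nil.
  rewrite big_cons; apply: (JD); first by apply: rP; rewrite inE eqxx.
  by apply: IH => j jr; apply: rP; rewrite inE jr orbT.
have JT ws : {subset ws <= Pi} -> J (T ws).
  have [n] := ubnP (size ws); elim: n ws => // n IH ws; rewrite ltnS => szn sub.
  have [[v vne]|nex] :=
    pselect (exists v, pairing rs (word_op rs ws v) l != pairing rs v l).
    have [r [rP e]] := theta_word v sub.
    set d := (pairing rs (word_op rs ws v) l)%:C - (pairing rs v l)%:C.
    have d0 : d != 0.
      by rewrite subr_eq0 (inj_eq (fmorph_inj (real_complex R))).
    rewrite -[T ws]scale1r -(mulVf d0) -scalerA; apply: (JZ).
    have -> : d *: T ws = (theta (sym_of v) - (pairing rs v l)%:C%:A) * T ws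
        - T ws * (theta (sym_of (word_op rs ws v)) -
            (pairing rs (word_op rs ws v) l)%:C%:A)
        - \sum_(c <- r) c.1 *: T c.2.
      rewrite mulrBl mulrBr e mulr_algl mulr_algr scalerBl.
      apply/eqP; rewrite eq_sym !subr_eq [X in _ == X]addrAC (addrAC (_ - _)).
      by rewrite subrK [X in _ == X]addrC addrA subrK.
    apply: (JD); last apply: (JN).
      by apply: (JD) => //; apply: (JN).
    apply: Jsum => c cr; have [csub csz] := rP c cr; apply: JZ.
    by apply: IH => //; apply: leq_trans szn.
  have w1 : word_op rs ws = \1%VF.
    apply: (regular_stabilizer Pi_simple sub (l := l)) => [b /root_ge1|v].
      exact: lt_le_trans.
    by apply/eqP/negPn/negP=> vne; apply: nex; exists v.
  rewrite -(t_word Pi_simple HH sub).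
  have := word_op_rev Pi_simple sub; rewrite w1 comp_lfun1l => ->.
  by rewrite hecke_t1.
elim/(hecke_word_ind Pi_simple) => // ws p sub.
rewrite -(subrK (weight \1%VF p)%:A (theta p)) mulrDr mulr_algr.
by apply: JD => //; apply/JZ/JT.
Qed.

Context (X : lmodType HH) (X_irr : irreducible X) (X_sph : spherical X).
Context (x : X) (x0 : x != 0) (wx : weight_vector nu \1%VF x).

Definition weight_sum (y : X) := exists r : seq ('End(V) * X),
  (forall p, p \in r -> weyl_group rs p.1 /\ weight_vector nu p.1 p.2) /\
  y = \sum_(p <- r) p.2.

Lemma weight_sum_vector u y :
  weyl_group rs u -> weight_vector nu u y -> weight_sum y.
Proof.
move=> uW wy; exists [:: (u, y)]; rewrite big_seq1; split=> // p.
by rewrite inE => /eqP->.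
Qed.

Lemma weight_sum0 : weight_sum 0.
Proof. by exists [::]; rewrite big_nil. Qed.

Lemma weight_sumD y z : weight_sum y -> weight_sum z -> weight_sum (y + z).
Proof.
move=> [r [rP ->]] [q [qP ->]]; exists (r ++ q); rewrite big_cat; split=> // p.
by rewrite mem_cat => /orP[/rP|/qP].
Qed.

Lemma weight_sum_ind (P : X -> Prop) : P 0 ->
    (forall y z, P y -> P z -> P (y + z)) ->
    (forall u y, weyl_group rs u -> weight_vector nu u y -> P y) ->
  forall y, weight_sum y -> P y.
Proof.
move=> P0 PD Pw _ [r [rP ->]]; rewrite big_seq; elim/big_ind: _ => // p /rP[pW].
exact: Pw.
Qed.

(** Since $\nu$ is regular, $t_\alpha$ is a combination of an intertwiner and
    the identity on every weight vector, so the sum of the weight spaces is a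
    submodule. *)
Lemma weight_sum_all y : weight_sum y.
Proof.
have [h ->] := irreducible_gen X_irr x0 y.
apply: (hecke_module_ind Pi_simple (P := weight_sum)) => [||p z|a z aPi|].
- exact: weight_sum0.
- exact: weight_sumD.
- elim/weight_sum_ind => [|z1 z2 P1 P2|u z1 uW wz].
  + by rewrite scaler0; apply: weight_sum0.
  + by rewrite scalerDr; apply: weight_sumD.
  + by rewrite wz; apply: (weight_sum_vector uW); apply: weight_vectorZ.
- elim/weight_sum_ind => [|z1 z2 P1 P2|u z1 uW wz].
  + by rewrite scaler0; apply: weight_sum0.
  + by rewrite scalerDr; apply: weight_sumD.
  have aR := simple_root Pi_simple aPi.
  have n0 : weight u (sym_of a) != 0.
    rewrite weight_real // fmorph_eq0.
    have [/root_ge1|/root_ge1] := root_sign Pi_simple (weyl_roots uW aR).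
      by move=> h1; rewrite gt_eqF //; lra.
    by rewrite pairingNl => h1; rewrite lt_eqF //; lra.
  rewrite -(subrK ((weight u (sym_of a))^-1 *:: z1) (t (s a) *: z1)).
  apply: weight_sumD; last first.
    by apply: (weight_sum_vector uW); apply: weight_vectorZ.
  apply: weight_sum_vector (intertwine_weight aPi n0 wz).
  by apply: weyl_groupC => //; apply: weyl_reflection.
- by apply: weight_sum_vector wx; constructor.
Qed.

(** The sum of the weight spaces other than that of $\nu$, described so that
    its independence from the latter is immediate. *)
Definition off_weight (y : X) :=
  exists2 p, weight \1%VF p != 0 & theta p *: y = 0.

Lemma off_weight0 : off_weight 0.
Proof. by exists 1; rewrite ?scaler0 // -mpolyC1 weightC oner_eq0. Qed.

Lemma off_weightD y z : off_weight y -> off_weight z -> off_weight (y + z).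
Proof.
move=> [p p0 py] [q q0 qz]; exists (p * q); first by rewrite weightM mulf_neq0.
rewrite scalerDr [X in X + _]theta_scaleM theta_scaleC py scaler0 add0r.
by rewrite theta_scaleM qz scaler0.
Qed.

Lemma off_weightZ c y : off_weight y -> off_weight (c *:: y).
Proof.
by move=> [p p0 py]; exists p => //; rewrite cscale_comm py cscale0r.
Qed.

Lemma off_weight_eq0 y : off_weight y -> weight_vector nu \1%VF y -> y = 0.
Proof. by move=> [p p0 py] wy; move: py; rewrite wy; apply: cscale_inj0. Qed.

Lemma off_weight_theta v y :
  off_weight (theta (sym_of v) *: y - (pairing rs v l)%:C *:: y).
Proof.
elim/weight_sum_ind: y / (weight_sum_all y) => [|y z Py Pz|u y uW wy].
- by rewrite scaler0 cscale0r subr0; apply: off_weight0.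
- by rewrite scalerDr cscaleDr opprD addrACA; apply: off_weightD.
have [e|] := eqVneq (weight u) (weight \1%VF).
  by rewrite wy e weight_real // id_lfunE subrr; apply: off_weight0.
move=> /eqP ne.
have [w wne] : exists w, weight u (sym_of w) != weight \1%VF (sym_of w).
  apply: contrapT => nex; apply: ne; apply/funext; apply: eq_weight => w.
  by apply/eqP/negPn/negP=> wne; apply: nex; exists w.
rewrite wy -cscaleNl -cscaleDl; apply: off_weightZ.
exists (sym_of w - (weight u (sym_of w))%:MP).
  by rewrite weightB weightC subr_eq0 eq_sym.
by rewrite wy weightB weightC subrr cscale0l.
Qed.

Lemma off_weight_coef h : exists c, off_weight (h *: x - c *:: x).
Proof.
elim/hecke_bimodule_ind: h => [|h k [c hP] [d kP]|c h [d hP]||v h|v h].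
- by exists 0; rewrite scale0r cscale0l subr0; apply: off_weight0.
- exists (c + d); rewrite scalerDl cscaleDl opprD addrACA; exact: off_weightD.
- exists (c * d); rewrite scaler_cscale -cscaleA -cscaleNr -cscaleDr.
  exact: off_weightZ.
- by exists 1; rewrite scale1r cscale1 subrr; apply: off_weight0.
- exists 0; rewrite cscale0l subr0 -scalerA scalerBl; exact: off_weight_theta.
- exists 0; rewrite cscale0l subr0 -scalerA scalerBl wx weight_real // id_lfunE.
  by rewrite subrr scaler0; apply: off_weight0.
Qed.

(** The coefficient of x in hx. *)
Definition matrix_coef h := projT1 (cid (off_weight_coef h)).

Lemma matrix_coefP h : off_weight (h *: x - matrix_coef h *:: x).
Proof. exact: projT2 (cid (off_weight_coef h)). Qed.

Lemma matrix_coef_eq h c : off_weight (h *: x - c *:: x) -> matrix_coef h = c.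
Proof.
move=> hc; have := off_weightD (matrix_coefP h) (off_weightZ (-1) hc).
rewrite cscaleNl cscale1 opprB addrC addrA subrK -cscaleNl.
rewrite -cscaleDl => /off_weight_eq0/(_ (weight_vectorZ _ wx)) cx.
apply/eqP; rewrite eq_sym -subr_eq0; apply: contraNT x0 => /cscale_inj0/(_ cx).
by move=> ->.
Qed.

Lemma matrix_coefD h k : matrix_coef (h + k) = matrix_coef h + matrix_coef k.
Proof.
apply: matrix_coef_eq; rewrite scalerDl cscaleDl opprD addrACA.
by apply: off_weightD; apply: matrix_coefP.
Qed.

Lemma matrix_coefZ c h : matrix_coef (c *: h) = c * matrix_coef h.
Proof.
apply: matrix_coef_eq; rewrite scaler_cscale -cscaleA -cscaleNr -cscaleDr.
by apply: off_weightZ; apply: matrix_coefP.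
Qed.

Lemma matrix_coef_kill h k : k *: x = 0 -> matrix_coef (h * k) = 0.
Proof.
move=> kx; apply: matrix_coef_eq; rewrite -scalerA kx scaler0 cscale0l subr0.
exact: off_weight0.
Qed.

Lemma matrix_coef1 : matrix_coef 1 = 1.
Proof.
by apply: matrix_coef_eq; rewrite scale1r cscale1 subrr; apply: off_weight0.
Qed.

Lemma matrix_coef_l v h :
  matrix_coef ((theta (sym_of v) - (pairing rs v l)%:C%:A) * h) = 0.
Proof.
apply: matrix_coef_eq; rewrite cscale0l subr0 -scalerA scalerBl.
exact: off_weight_theta.
Qed.

Lemma matrix_coef_r v h :
  matrix_coef (h * (theta (sym_of v) - (pairing rs v l)%:C%:A)) = 0.
Proof.
apply: matrix_coef_kill; rewrite scalerBl wx weight_real // id_lfunE subrr.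
by [].
Qed.

Lemma bulletD h k : bullet (h + k) = bullet h + bullet k.
Proof.
by have := bullet_conj_linear bulletP 1 h k; rewrite scale1r rmorph1 scale1r.
Qed.

Lemma bullet0 : bullet 0 = 0.
Proof. by apply: (addrI (bullet 0)); rewrite -bulletD !addr0. Qed.

Lemma bulletZ c h : bullet (c *: h) = Num.conj c *: bullet h.
Proof. by have := bullet_conj_linear bulletP c h 0; rewrite bullet0 !addr0. Qed.

Lemma bullet1 : bullet 1 = 1.
Proof.
have := bullet_antimul bulletP (bullet 1) 1.
by rewrite mulr1 (bullet_invol bulletP) mulr1.
Qed.

Lemma bullet_shift v : bullet (theta (sym_of v) - (pairing rs v l)%:C%:A) =
  theta (sym_of v) - (pairing rs v l)%:C%:A.
Proof.
rewrite -scaleNr bulletD bullet_of // bulletZ bullet1 rmorphN /= conj_real.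
by rewrite scaleNr.
Qed.

(** Both sides are functionals that vanish on the multiples of the
    $v-(v,\nu)$ and agree at 1. *)
Lemma matrix_coef_bullet h : matrix_coef (bullet h) = Num.conj (matrix_coef h).
Proof.
have c0 : matrix_coef 0 = 0.
  by rewrite -(scale0r (0 : HH)) matrix_coefZ mul0r.
elim/hecke_bimodule_ind: h => [|h k hP kP|c h hP||v h|v h].
- by rewrite bullet0 c0 rmorph0.
- by rewrite bulletD !matrix_coefD hP kP rmorphD.
- by rewrite bulletZ !matrix_coefZ hP rmorphM.
- by rewrite bullet1 matrix_coef1 rmorph1.
- by rewrite bullet_antimul // bullet_shift matrix_coef_r matrix_coef_l rmorph0.
- by rewrite bullet_antimul // bullet_shift matrix_coef_r matrix_coef_l rmorph0.
Qed.

Definition lift_x y := projT1 (cid (irreducible_gen X_irr x0 y)).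

Lemma lift_xK y : lift_x y *: x = y.
Proof. by rewrite /lift_x; case: cid. Qed.

(** $\langle hx,kx\rangle=\phi(k^\bullet h)$ for the matrix coefficient $\phi$
    of x. *)
Definition coef_form (y z : X) := matrix_coef (bullet (lift_x z) * lift_x y).

Lemma coef_formE h k : coef_form (h *: x) (k *: x) = matrix_coef (bullet k * h).
Proof.
have coef_eq g h1 h2 : h1 *: x = h2 *: x ->
    matrix_coef (g * h1) = matrix_coef (g * h2).
  move=> e; apply/eqP; rewrite -subr_eq0 -mulN1r -matrix_coefZ -matrix_coefD.
  apply/eqP; rewrite scaleN1r -mulrBr; apply: matrix_coef_kill.
  by rewrite scalerBl e subrr.
rewrite /coef_form (coef_eq _ _ h) ?lift_xK //.
have conj_eq g1 g2 : matrix_coef (bullet g1 * g2) =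
    Num.conj (matrix_coef (bullet g2 * g1)).
  by rewrite -matrix_coef_bullet bullet_antimul // (bullet_invol bulletP).
by rewrite [LHS]conj_eq (coef_eq (bullet h) _ k) ?lift_xK // -conj_eq.
Qed.

Lemma coef_form_linl (c : R[i]) y z w :
  coef_form ((c%:A : HH) *: y + z) w = c * coef_form y w + coef_form z w.
Proof.
rewrite -(lift_xK y) -(lift_xK z) -(lift_xK w) scalerA -scalerDl !coef_formE.
by rewrite mulrDr matrix_coefD mulr_algl -scalerAr matrix_coefZ.
Qed.

Lemma coef_form_conj y z : coef_form z y = Num.conj (coef_form y z).
Proof.
rewrite -(lift_xK y) -(lift_xK z) !coef_formE -matrix_coef_bullet.
by rewrite bullet_antimul // (bullet_invol bulletP).
Qed.

Lemma coef_form_adj h y z : coef_form (h *: y) z = coef_form y (bullet h *: z).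
Proof.
rewrite -(lift_xK y) -(lift_xK z) !scalerA !coef_formE.
by rewrite bullet_antimul // (bullet_invol bulletP) mulrA.
Qed.

Lemma nu_dominant_of_ge1 : dominant rs Pi nu.
Proof. by move=> a /nu_ge1; apply: le_trans. Qed.

(** Every weight vector is brought to the line of x by intertwiners which do
    not kill it, and each multiplies the squared norm by
    $1-(\beta,\nu)^{-2}\ge0$ for a root $\beta$. *)
Lemma coef_form_weight_gt0 u y : weyl_group rs u -> y != 0 ->
  weight_vector nu u y -> 0 < coef_form y y.
Proof.
apply: (weight_ind Pi_simple X_irr X_sph nu_real nu_dominant_of_ge1
  (P := fun y => 0 < coef_form y y)) => {u}{}y.
  move=> y0 wy; pose c := matrix_coef (lift_x y).
  have yE : y = c *:: x.
    apply/eqP; rewrite -subr_eq0; apply/eqP; apply: off_weight_eq0.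
      by rewrite -{1}(lift_xK y); apply: matrix_coefP.
    by rewrite -cscaleNl; apply: weight_vectorD => //; apply: weight_vectorZ.
  have c0 : c != 0.
    by apply: contra_neq y0 => c0; rewrite yE c0 cscale0l.
  rewrite yE (formZl coef_form_linl) (formZr coef_form_linl coef_form_conj).
  rewrite -[x]scale1r coef_formE bullet1 mulr1 matrix_coef1 mulr1.
  by rewrite mul_conjC_gt0.
move=> a z uW aPi z0 wz neg.
have aR := simple_root Pi_simple aPi.
have n0 : pairing rs (y a) l != 0 by rewrite lt_eqF.
rewrite (form_intertwine Pi_simple bulletP coef_form_linl coef_form_conj
  coef_form_adj nu_real aPi n0 wz).
have n1 : pairing rs (y a) l <= -1.
  have [/root_ge1|/root_ge1] := root_sign Pi_simple (weyl_roots uW aR).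
    by move: neg; lra.
  by rewrite pairingNl; lra.
have d0 : 0 <= 1 - (pairing rs (y a) l) ^- 2.
  rewrite subr_ge0 invf_le1; first by nra.
  by rewrite exprn_even_gt0.
have [->|d1] := eqVneq (1 - (pairing rs (y a) l) ^- 2) 0.
  by rewrite mul0r ltxx.
by rewrite pmulr_rgt0 // -(rmorph0 (real_complex R)) ltcR lt_neqAle eq_sym d1.
Qed.

(** Gather the components with the weight of the first term; they form a single
    weight vector, orthogonal to the sum of the others. *)
Lemma coef_form_gt0 y : y != 0 -> 0 < coef_form y y.
Proof.
have linl := coef_form_linl; have conjf := coef_form_conj.
have [r [rP ->]] := weight_sum_all y.
suff [->|//] : \sum_(p <- r) p.2 = 0 \/
    0 < coef_form (\sum_(p <- r) p.2) (\sum_(p <- r) p.2) by rewrite eqxx.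
have [n] := ubnP (size r); elim: n r rP => // n IH [|p0 r] rP szn.
  by left; rewrite big_nil.
pose same (p : 'End(V) * X) :=
  `[< forall v, pairing rs (p0.1 v) l = pairing rs (p.1 v) l >].
rewrite (bigID same) /= -(big_filter _ same).
rewrite -(big_filter _ (fun p => ~~ same p)).
set A := [seq p <- _ | same p]; set B := [seq p <- _ | ~~ same p].
have p0s : same p0 by apply/asboolP.
have szB : (size B < n)%N.
  rewrite /B /= p0s /= size_filter; apply: leq_ltn_trans (count_size _ _) _.
  by rewrite -ltnS.
have [p0W _] : weyl_group rs p0.1 /\ weight_vector nu p0.1 p0.2.
  by apply: rP; rewrite inE eqxx.
have wA : weight_vector nu p0.1 (\sum_(p <- A) p.2).
  rewrite /A big_filter big_seq_cond; elim/big_ind: _ => [|y1 y2|p].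
  - exact: weight_vector0.
  - exact: weight_vectorD.
  move=> /andP[/rP[_ wp] /asboolP e]; apply: eq_weight_vector wp.
  by apply: eq_weight => v; rewrite !weight_real // e.
have orth : coef_form (\sum_(p <- A) p.2) (\sum_(p <- B) p.2) = 0.
  move: (\sum_(p <- A) p.2) wA => yA wA.
  rewrite /B big_filter big_seq_cond; elim/big_ind: _ => [|y1 y2 e1 e2|p].
  - exact: form0r.
  - by rewrite formDr // e1 e2 addr0.
  move=> /andP[/rP[_ wp] /asboolP ne].
  have [v vne] : exists v, pairing rs (p0.1 v) l != pairing rs (p.1 v) l.
    apply: contrapT => nex; apply: ne => v; apply/eqP/negPn/negP => h.
    by apply: nex; exists v.
  apply: (form_weight_orth bulletP linl conjf coef_form_adj (v := v) wA wp).
  by rewrite !weight_real // conj_real (inj_eq (fmorph_inj (real_complex R))).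
have orth' : coef_form (\sum_(p <- B) p.2) (\sum_(p <- A) p.2) = 0.
  by rewrite conjf orth rmorph0.
rewrite formDl // !formDr // orth orth' addr0 add0r.
have {IH} := IH B _ szB; case=> [p|->|posB].
- by rewrite mem_filter => /andP[_ /rP].
- rewrite addr0 (form0l linl) addr0.
  have [->|A0] := eqVneq (\sum_(p <- A) p.2) 0.
    by left.
  by right; apply: coef_form_weight_gt0 wA.
- right; have [->|A0] := eqVneq (\sum_(p <- A) p.2) 0.
    by rewrite (form0l linl) add0r.
  by apply: addr_gt0 => //; apply: coef_form_weight_gt0 wA.
Qed.

Lemma unitary_of_ge1 : unitary bullet X.
Proof.
exists coef_form; split.
- exact: coef_form_linl.
- exact: coef_form_conj.
- exact: coef_form_gt0.
- exact: coef_form_adj.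
Qed.

End UnitarySufficient.

(** * The unitarity criterion *)

Theorem theorem6p3p3 (R : realType) (V V' : vectType R)
    (rs : root_system V V') (Pi : seq V) (Pi_simple : simple_roots rs Pi)
    (HH : graded_hecke rs Pi) (bullet : HH -> HH) (bulletP : is_bullet bullet)
    (nu : complexified V') (nu_dominant : dominant rs Pi nu)
    (X : lmodType HH) (X_sph : spherical_subquotient nu X) :
  (im_part nu = 0%R ->
     (unitary bullet X <-> vclosure (C_infty rs Pi) (re_part nu))) /\
  (im_part nu <> 0%R -> ~ unitary bullet X).
Proof.
case: X_sph => Xsub Xirr Xsph.
have Xfin (x : X) : weight_finite nu x by apply: subquotient_finite.
split=> [nu_real|im0 U]; last first.
  by apply: im0; apply: (unitary_real bulletP Xirr Xfin U).
rewrite closure_C_infty; split=> [U|nu_ge1].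
  exact: (unitary_ge1 Pi_simple bulletP Xirr Xfin Xsph nu_dominant U).
have [x x0 wx] :=
  dominant_weight_vector Pi_simple Xirr Xsph nu_real nu_dominant Xfin.
exact: (unitary_of_ge1 Pi_simple bulletP nu_real nu_ge1 Xirr Xsph x0 wx).
Qed.
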